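(* Let $K$ be a field, $S=K[x_1,\ldots,x_n]$ with $n\leq 7$, and let $(0)\neq I\subset S$ be a proper squarefree monomial ideal. Then $\operatorname{hdepth}(I)\geq \operatorname{hdepth}(S/I)$.
   Context: $S=K[x_1,\ldots,x_n]$ is the polynomial ring over a field $K$ with its standard grading. For a nonzero finitely generated graded $S$-module $M$, the Hilbert depth $\operatorname{hdepth}(M)$ is the maximal depth of a finitely generated graded $S$-module $N$ having the same Hilbert series as $M$. *)

(* Defs.v *)
From HB Require Import structures.
From mathcomp Require Import all_boot all_order all_algebra.
From mathcomp Require Import ring_quotient mpoly.
From mathcomp Require Import boolp classical_sets.

Set Implicit Arguments.
Unset Strict Implicit.
Unset Printing Implicit Defensive.

Import GRing.Theory.
Local Open Scope ring_scope.
Local Open Scope quotient_scope.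

(* Equal to 0 when [P] has no maximum; the maxima taken below all exist, as the
   depth of a nonzero finitely generated graded module is at most n. *)
Definition nat_max (P : set nat) : nat :=
  xget 0%N [set m | P m /\ forall k, P k -> (k <= m)%N]%classic.

Section GradedModules.
Variables (K : fieldType) (n : nat).
Local Notation S := {mpoly K[n]}.

Section Module.
Variable M : lmodType S.

Definition fin_gen : Prop :=
  exists s : seq M, forall v : M,
    exists c : 'I_(size s) -> S, v = \sum_(i < size s) c i *: s`_i.

(* Z-gradings: [Mdeg j] is the component of degree [j].  Its stability under
   K is the case [d = 0] of [grading_scale]. *)
Record is_grading (Mdeg : int -> set M) : Prop := IsGrading {
  grading_0 : forall j, Mdeg j 0;
  grading_add : forall j u v, Mdeg j u -> Mdeg j v -> Mdeg j (u + v);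
  grading_scale : forall (d : nat) j (f : S) v,
    f \is d.-homog -> Mdeg j v -> Mdeg (d%:Z + j) (f *: v);
  grading_span : forall v, exists (s : seq int) (c : int -> M),
    (forall j, Mdeg j (c j)) /\ v = \sum_(j <- s) c j;
  grading_direct : forall (s : seq int) (c : int -> M),
    uniq s -> (forall j, Mdeg j (c j)) -> \sum_(j <- s) c j = 0 ->
    forall j, j \in s -> c j = 0 }.

Definition K_basis (U : set M) (d : nat) (b : 'I_d -> M) : Prop :=
  [/\ forall i, U (b i),
      forall c : 'I_d -> K, \sum_i (c i)%:MP *: b i = 0 -> forall i, c i = 0
    & forall u, U u -> exists c : 'I_d -> K, u = \sum_i (c i)%:MP *: b i].

(* Equal to 0 when [U] is infinite-dimensional; the components of a finitely
   generated graded module never are. *)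
Definition K_dim (U : set M) : nat :=
  xget 0%N [set d | exists b : 'I_d -> M, K_basis U b]%classic.

(* The coefficients of the Hilbert series. *)
Definition hilbert (Mdeg : int -> set M) (j : int) : nat := K_dim (Mdeg j).

(* The submodule (f_1, ..., f_r)M. *)
Definition seq_mul (fs : seq S) : set M :=
  fun v => exists w : 'I_(size fs) -> M, v = \sum_(i < size fs) fs`_i *: w i.

Definition regular_seq (fs : seq S) : Prop :=
  (forall i, (i < size fs)%N -> forall v : M,
     seq_mul (take i fs) (fs`_i *: v) -> seq_mul (take i fs) v) /\
  (exists v, ~ seq_mul fs v).

(* Depth with respect to (x_1, ..., x_n), the ideal of the polynomials with
   zero constant coefficient. *)
Definition depth : nat :=
  nat_max (fun r => exists fs : seq S,
    [/\ size fs = r, (forall f, f \in fs -> f@_0 = 0) & regular_seq fs]).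

End Module.

Definition hdepth (M : lmodType S) (Mdeg : int -> set M) : nat :=
  nat_max (fun r => exists (N : lmodType S) (Ndeg : int -> set N),
    [/\ fin_gen N, is_grading Ndeg, hilbert Ndeg = hilbert Mdeg
      & depth N = r]).

Definition poly_deg (j : int) : set S :=
  fun f => if j is Posz d then f \is d.-homog else f = 0.

Definition squarefree_mnm (m : 'X_{1..n}) : bool := [forall i, m i <= 1]%N.

Definition squarefree_monomial_ideal (I : {pred S}) : Prop :=
  exists2 G : seq 'X_{1..n}, all squarefree_mnm G &
    forall f : S, f \in I <->
      exists c : 'I_(size G) -> S, f = \sum_(i < size G) c i * 'X_[nth 0%MM G i].

Variable I : idealr S.

Record ideal_mod := IdealMod { ideal_val : S; _ : ideal_val \in I }.

HB.instance Definition _ := [isSub for ideal_val].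
HB.instance Definition _ := [Choice of ideal_mod by <:].
HB.instance Definition _ := [SubChoice_isSubZmodule of ideal_mod by <:].

Definition ideal_scale (f : S) (u : ideal_mod) : ideal_mod :=
  IdealMod (idealMr f (valP u)).

Fact ideal_scaleA f g u :
  ideal_scale f (ideal_scale g u) = ideal_scale (f * g) u.
Proof. by apply: val_inj; rewrite /= mulrA. Qed.
Fact ideal_scale1 : left_id 1 ideal_scale.
Proof. by move=> u; apply: val_inj; rewrite /= mul1r. Qed.
Fact ideal_scaleDr : right_distributive ideal_scale +%R.
Proof. by move=> f u v; apply: val_inj; rewrite /= mulrDr. Qed.
Fact ideal_scaleDl u : {morph ideal_scale^~ u : f g / f + g}.
Proof. by move=> f g; apply: val_inj; rewrite /= mulrDl. Qed.

HB.instance Definition _ := GRing.Zmodule_isLmodule.Build S ideal_mod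
  ideal_scaleA ideal_scale1 ideal_scaleDr ideal_scaleDl.

Definition ideal_deg (j : int) : set ideal_mod := fun u => poly_deg j (val u).

(* A copy of {ideal_quot I}, which is seen here as an S-module. *)
Definition quot_mod := {ideal_quot I}.

HB.instance Definition _ := GRing.Zmodule.on quot_mod.

Definition quot_scale (f : S) (u : quot_mod) : quot_mod :=
  \pi_{ideal_quot I} f * (u : {ideal_quot I}).

Fact quot_scaleA f g u : quot_scale f (quot_scale g u) = quot_scale (f * g) u.
Proof. by rewrite /quot_scale rmorphM mulrA. Qed.
Fact quot_scale1 : left_id 1 quot_scale.
Proof. by move=> u; rewrite /quot_scale rmorph1 mul1r. Qed.
Fact quot_scaleDr : right_distributive quot_scale +%R.
Proof. by move=> f u v; apply: mulrDr. Qed.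
Fact quot_scaleDl u : {morph quot_scale^~ u : f g / f + g}.
Proof. by move=> f g; rewrite /quot_scale rmorphD mulrDl. Qed.

HB.instance Definition _ := GRing.Zmodule_isLmodule.Build S quot_mod
  quot_scaleA quot_scale1 quot_scaleDr quot_scaleDl.

Definition quot_deg (j : int) : set quot_mod :=
  fun u => exists2 f : S, poly_deg j f & u = \pi_{ideal_quot I} f.

End GradedModules.

Section Gradings.
Variables (K : fieldType) (n : nat).
Local Notation S := {mpoly K[n]}.

Lemma poly_deg0 j : poly_deg j (0 : S).
Proof. by case: j => //= d; apply: rpred0. Qed.

Lemma poly_degD j (f g : S) : poly_deg j f -> poly_deg j g -> poly_deg j (f + g).
Proof. by case: j => [d|d] /=; [apply: rpredD | move=> -> ->; rewrite addr0]. Qed.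

Lemma poly_degM d j (f g : S) :
  f \is d.-homog -> poly_deg j g -> poly_deg (d%:Z + j) (f * g).
Proof.
by case: j => [e|e] /= hf hg; [apply: dhomogM | rewrite hg mulr0; apply: poly_deg0].
Qed.

Lemma pihomog_sum_deg (s : seq int) (c : int -> S) (d : nat) :
    uniq s -> (forall j, poly_deg j (c j)) -> d%:Z \in s ->
  pihomog mdeg d (\sum_(j <- s) c j) = c d%:Z.
Proof.
move=> us hc ds; rewrite raddf_sum (bigD1_seq _ ds us) /=.
rewrite big1 ?addr0 => [|j jd]; first exact: pihomog_dE (hc d%:Z).
case: j jd (hc j) => [e|e] /= ed he; last by rewrite he raddf0.
by apply: pihomog_ne0 he; apply: contra ed => /eqP->.
Qed.

Lemma sum_pihomog (f : S) :
  f = \sum_(j <- [seq d%:Z | d <- iota 0 (msize f)])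
        (if j is Posz d then pihomog mdeg d f else 0).
Proof.
by rewrite big_map -(subn0 (msize f)) big_mkord -pihomog_partitionE.
Qed.

Variable I : idealr S.
Hypothesis I_sqf : squarefree_monomial_ideal I.

Lemma pihomog_ideal d (f : S) : f \in I -> pihomog mdeg d f \in I.
Proof.
case: I_sqf => G _ defI /defI[c ->]; rewrite raddf_sum rpred_sum // => i _.
set m := nth _ _ _.
have Xm : 'X_[m] \in I.
  apply/defI; exists (fun j => (j == i)%:R).
  by rewrite (bigD1 i) //= eqxx mul1r big1 ?addr0 // => j /negPf->; rewrite mul0r.
rewrite [c i]mpolyE mulr_suml raddf_sum rpred_sum // => k _ /=.
rewrite -scalerAl -mpolyXD linearZ /= pihomogX.
case: ifP => _; last by rewrite scaler0 rpred0.
by rewrite -mul_mpolyC mpolyXD mulrA idealMr.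
Qed.

Lemma ideal_grading : is_grading (@ideal_deg K n I).
Proof.
split.
- by move=> j; apply: poly_deg0.
- by move=> j u v; apply: poly_degD.
- by move=> d j f v; apply: poly_degM.
- move=> v; have vI := valP v.
  pose c j : ideal_mod I :=
    if j is Posz d then IdealMod (pihomog_ideal d vI) else 0.
  exists [seq d%:Z | d <- iota 0 (msize (val v))], c; split.
    by case=> d //=; apply: pihomogP.
  apply: val_inj; rewrite raddf_sum [LHS]sum_pihomog.
  by apply: eq_bigr => -[].
- move=> s c us hc s0 j js; apply: val_inj; rewrite raddf0.
  case: j js => [d|d] js; last exact: (hc (Negz d)).
  rewrite /= -(@pihomog_sum_deg s (fun j => val (c j))) //.
  have /(congr1 val) := s0; rewrite raddf_sum raddf0 /= => ->.
  by rewrite raddf0.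
Qed.

Lemma ideal_fin_gen : fin_gen (ideal_mod I).
Proof.
case: I_sqf => G _ defI.
have XG (i : 'I_(size G)) : 'X_[nth 0%MM G i] \in I.
  apply/defI; exists (fun j => (j == i)%:R).
  by rewrite (bigD1 i) //= eqxx mul1r big1 ?addr0 // => j /negPf->; rewrite mul0r.
pose s := [seq IdealMod (XG i) | i <- enum 'I_(size G)].
have szs : size s = size G by rewrite size_map size_enum_ord.
exists s => v; have /defI[c vE] := valP v.
exists (fun i => c (cast_ord szs i)); apply: val_inj.
rewrite raddf_sum [LHS]vE (reindex (cast_ord szs)) /=; last first.
  by exists (cast_ord (esym szs)) => i _; rewrite ?cast_ordK ?cast_ordKV.
apply: eq_bigr => i _; have iG : (i < size G)%N by rewrite -szs.
rewrite (nth_map (Ordinal iG)) ?size_enum_ord //=; congr (_ * 'X_[nth _ _ _]).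
by rewrite nth_enum_ord.
Qed.

Lemma quot_grading : is_grading (@quot_deg K n I).
Proof.
split.
- by move=> j; exists 0; [apply: poly_deg0 | rewrite raddf0].
- move=> j _ _ [f hf ->] [g hg ->].
  by exists (f + g); [apply: poly_degD | rewrite raddfD].
- move=> d j f _ hf [g hg ->].
  by exists (f * g); [apply: poly_degM | rewrite rmorphM].
- move=> v; pose f : S := repr (v : {ideal_quot I}).
  exists [seq d%:Z | d <- iota 0 (msize f)], (fun j =>
    \pi_{ideal_quot I} (if j is Posz d then pihomog mdeg d f else 0)); split.
    move=> j; eexists; last by [].
    by case: j => d //=; apply: pihomogP.
  by rewrite -[LHS](reprK (v : {ideal_quot I})) -/f {1}(sum_pihomog f) raddf_sum.
- move=> s c us /(_ _)/cid2-/all_sig2[g hg cE] s0.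
  have gI : \sum_(j <- s) g j \in I.
    have: \pi_{ideal_quot I} (\sum_(j <- s) g j) = 0.
      by rewrite raddf_sum -[RHS]s0; apply: eq_bigr => j _; rewrite cE.
    by move/eqP; rewrite -(raddf0 \pi_{ideal_quot I}) -Quotient.idealrBE subr0.
  case=> d ds; rewrite cE; last by rewrite (hg (Negz d)) raddf0.
  rewrite -(pihomog_sum_deg us hg ds); apply/eqP.
  by rewrite -(raddf0 \pi_{ideal_quot I}) -Quotient.idealrBE subr0 pihomog_ideal.
Qed.

Lemma quot_fin_gen : fin_gen (quot_mod I).
Proof.
exists [:: (1 : {ideal_quot I}) : quot_mod I] => v.
exists (fun=> repr (v : {ideal_quot I})); rewrite big_ord1 /=.
by rewrite -[LHS](reprK (v : {ideal_quot I})) -[LHS]mulr1.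
Qed.

End Gradings.

(* Main.v *)
Require Import Defs.
From HB Require Import structures.
From mathcomp Require Import all_boot all_order all_algebra.
From mathcomp Require Import ring_quotient mpoly.
From mathcomp Require Import zify boolp.
From mathcomp Require classical_sets.

Set Implicit Arguments.
Unset Strict Implicit.
Unset Printing Implicit Defensive.

Import GRing.Theory Num.Theory Order.TTheory.

(** The theorem is a statement about the simplicial complex of the supports of
    the monomials outside [I], its faces.

    The number of monomials of a given degree whose support is exactly [A]
    depends on [A] through its cardinal only, so the Hilbert functions of [S/I]
    and of [I] are sums over the faces and over the non-faces ([hilbert_quot],
    [hilbert_ideal], [mono_countE]).  Multiplying a Hilbert series by [1 - t]
    means taking differences of the Hilbert function.  For a family [F] of
    supports, the [d]-fold difference takes in degree [k <= d] the value
    [beta d F k], an alternating sum of the numbers of members of [F] of each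
    size ([delta_mono_count_beta]), and it is nonnegative beyond degree [d].

    The sign of these numbers decides the Hilbert depth, in both directions.

    - If a finitely generated graded module has a regular sequence of length
      [r] in the ideal of the variables, then the [r]-fold difference of its
      Hilbert function is nonnegative ([weakly_regular_delta]).  This is clear
      for a sequence of linear forms, which exists over an infinite field.  The
      field is arbitrary here and the sequence need not be homogeneous, so an
      indeterminate [u] is adjoined: the generic linear form
      [Y = x_0 + u x_1 + u^2 x_2 + ...] is a nonzero divisor as soon as one
      element of the ideal of the variables is one ([nonzerodiv_generic]), and
      exchanging neighbours moves it from the end of the sequence to the front
      ([regular_generic]).  Then [N[u] / Y N[u]] carries a regular sequence of
      length [r - 1], and its graded components are modules over [K[u]] whose
      ranks are the differences of the former ones.  Iterating replaces the
      field by polynomial rings in more and more variables, which is why ranks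
      are taken over arbitrary integral domains.

    - If [beta d F k >= 0] for all [k <= d], then the Hilbert function of [F]
      is that of a direct sum of shifted polynomial rings in at least [d]
      variables ([mono_count_decomp], [realizable_mono_count]), on which
      [x_0, ..., x_(d-1)] is regular.

    It remains to see that, for [n <= 7] and [1 <= d <= n], nonnegativity of
    the numbers [beta d F k] for the faces implies nonnegativity for the
    non-faces ([beta_complement]).  The face numbers obey the Kruskal-Katona
    inequalities ([shadow_bound]), which together with the sign conditions
    leave few enough vectors to examine them all by computation.

    Finally, a regular sequence has length at most [n]
    ([mono_count_bound], [regular_seq_size]), so that the maxima which define
    depth and Hilbert depth exist. *)

(** * Shadows and compression of set families *)

Section Shadow.
Variable T : finType.
Implicit Types (A B : {set T}) (F : {set {set T}}).

Definition shadow F : {set {set T}} :=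
  [set B : {set T} | [exists x, (x \notin B) && (x |: B \in F)]].

Lemma shadowP F B :
  reflect (exists2 x, x \notin B & x |: B \in F) (B \in shadow F).
Proof.
rewrite inE; apply: (iffP existsP) => [[x /andP[xB xF]]|[x xB xF]]; exists x => //.
by rewrite xB.
Qed.

Definition swap (y z : T) (x : T) := if x == y then z else if x == z then y else x.

Lemma swapK y z : involutive (swap y z).
Proof.
move=> x; rewrite /swap; case: (eqVneq x y) => [->|xy].
  by rewrite eqxx; case: eqP.
by case: (eqVneq x z) => [->|xz]; rewrite ?eqxx // (negPf xy) (negPf xz).
Qed.

Definition swap_set (y z : T) A : {set T} := [set x | swap y z x \in A].

Lemma swap_setK y z : involutive (swap_set y z).
Proof. by move=> A; apply/setP => x; rewrite !inE swapK. Qed.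

Lemma card_swap_set y z A : #|swap_set y z A| = #|A|.
Proof.
rewrite -(card_imset A (inv_inj (swapK y z))); apply: eq_card => x.
rewrite inE; apply/idP/imsetP => [sA|[u uA ->]]; last by rewrite swapK.
by exists (swap y z x); rewrite ?swapK.
Qed.

Lemma mem_swap_setl y z A : (y \in swap_set y z A) = (z \in A).
Proof. by rewrite inE /swap eqxx. Qed.

Lemma mem_swap_setr y z A : (z \in swap_set y z A) = (y \in A).
Proof. by rewrite inE /swap eqxx; case: eqP => // ->. Qed.

(** The compression that replaces [y] by [z] where this gives a new set, written
    as a membership test: among two sets exchanged by the transposition of [y]
    and [z], the one that contains [z] is served first. *)
Definition compress y z F : {set {set T}} :=
  [set A : {set T} | if (z \in A) && (y \notin A) then (A \in F) || (swap_set y z A \in F)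
           else if (y \in A) && (z \notin A) then (A \in F) && (swap_set y z A \in F)
           else A \in F].

Lemma in_compress y z F A : (A \in compress y z F) =
  if (z \in A) && (y \notin A) then (A \in F) || (swap_set y z A \in F)
  else if (y \in A) && (z \notin A) then (A \in F) && (swap_set y z A \in F)
  else A \in F.
Proof. by rewrite in_set. Qed.

(** The transposition acts on all sets, and on each of its orbits compression
    keeps the number of members. *)
Lemma card_compress y z F : #|compress y z F| = #|F|.
Proof.
have E A : (A \in compress y z F) + (swap_set y z A \in compress y z F) =
           (A \in F) + (swap_set y z A \in F).
  rewrite !in_compress swap_setK mem_swap_setl mem_swap_setr.
  case: (boolP (z \in A)) => zA; case: (boolP (y \in A)) => yA //=;
  by move: (A \in F) (swap_set y z A \in F) => [] [].
have D (G : {set {set T}}) : (#|G|).*2 = \sum_A ((A \in G) + (swap_set y z A \in G)).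
  have S : \sum_A (A \in G : nat) = #|G| 
    by rewrite -sum1_card [RHS]big_mkcond; apply: eq_bigr => B _; case: (B \in G).
  rewrite big_split /= S -addnn; congr (_ + _).
  rewrite -S (reindex_inj (inv_inj (swap_setK y z))) /=.
  by apply: eq_bigr.
by apply: double_inj; rewrite !D; apply: eq_bigr => A _; apply: E.
Qed.

(** With [card_compress], this says that compression does not enlarge shadows. *)
Lemma shadow_compress y z F : shadow (compress y z F) \subset compress y z (shadow F).
Proof.
case: (eqVneq y z) => [->|yz].
  have id (G : {set {set T}}) : compress z z G = G.
    by apply/setP => A; rewrite in_compress !andbN.
  by rewrite !id.
apply/subsetP => B /shadowP[x xB]; rewrite !in_compress.
have shB (G : {set {set T}}) : x |: B \in G -> B \in shadow G.
  by move=> h; apply/shadowP; exists x.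
have sws : swap_set y z (x |: B) \in F -> swap_set y z B \in shadow F.
  move=> h; apply/shadowP; exists (swap y z x); first by rewrite inE swapK.
  suff <- : swap_set y z (x |: B) = swap y z x |: swap_set y z B by [].
  by apply/setP => u; rewrite !inE (can2_eq (swapK y z) (swapK y z)).
rewrite [z \in x |: B]in_setU1 [y \in x |: B]in_setU1.
case: (eqVneq x y) xB shB sws => [->|xy] xB shB sws.
- rewrite [z == y]eq_sym (negPf yz) (negPf xB) /= andbF andbT /=.
  case: (boolP (z \in B)) => zB /=.
    by move=> /shB ->.
  by case/andP => /shB.
case: (eqVneq x z) xB shB sws => [->|xz] xB shB sws.
- rewrite (negPf xB) /= andbT.
  case: (boolP (y \in B)) => yB /= h.
    rewrite (shB _ h) /=; apply/shadowP; exists y; first by rewrite mem_swap_setl.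
    suff -> : y |: swap_set y z B = z |: B by [].
    apply/setP => u; rewrite !inE /swap.
    case: (eqVneq u y) => [->|uy] /=; first by rewrite (negPf yz) yB.
    by case: (eqVneq u z) => [->|].
  case/orP: h; first by move/shB.
  move=> h; apply/shadowP; exists y => //.
  suff <- : swap_set y z (z |: B) = y |: B by [].
  apply/setP => u; rewrite !inE /swap.
  case: (eqVneq u y) => [->|uy] /=; first by rewrite eqxx.
  case: (eqVneq u z) => [->|uz] /=; first by rewrite (negPf xB) (negPf yz) (negPf yB).
  by rewrite (negPf uz).
rewrite /=.
case: ifP => _; first by case/orP => [/shB -> //|/sws ->]; rewrite orbT.
case: ifP => _; last exact: shB.
by case/andP => /shB -> /sws ->.
Qed.

Definition star z F : {set {set T}} := [set A in F | z \in A].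
Definition link z F : {set {set T}} := [set B : {set T} | (z \notin B) && (z |: B \in F)].
Definition deletion z F : {set {set T}} := [set A in F | z \notin A].

Lemma card_link z F : #|link z F| = #|star z F|.
Proof.
have <- : [set A :\ z | A in star z F] = link z F.
  apply/setP => B; rewrite !inE; apply/imsetP/andP => [[A]|[zB BF]].
    by rewrite inE => /andP[AF zA] ->; rewrite setD11 setD1K.
  by exists (z |: B); rewrite ?inE ?BF ?eqxx ?setU1K.
rewrite card_in_imset // => A B; rewrite !inE => /andP[_ zA] /andP[_ zB] E.
by rewrite -(setD1K zA) -(setD1K zB) E.
Qed.

Lemma card_link_deletion z F : #|link z F| + #|deletion z F| = #|F|.
Proof.
rewrite card_link -(cardsID [set A : {set T} | z \in A] F); congr (_ + _).
  by apply: eq_card => A; rewrite !inE.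
by apply: eq_card => A; rewrite !inE andbC.
Qed.

(** Every compression that changes the family increases the number of members
    containing [z], so that compressing towards [z] comes to an end. *)
Lemma exists_compressed z F : exists G : {set {set T}},
  [/\ #|G| = #|F|, #|shadow G| <= #|shadow F|,
      (forall k, {in F, forall A, #|A| = k} -> {in G, forall A, #|A| = k}),
      #|star z F| <= #|star z G| &
      forall y A, A \in G -> y \in A -> z \notin A -> swap_set y z A \in G].
Proof.
have [m] := ubnP (#|F| - #|star z F|); elim: m F => // m IH F lem.
case: (pickP (fun p : T * {set T} =>
   [&& p.2 \in F, p.1 \in p.2, z \notin p.2 & swap_set p.1 z p.2 \notin F])) => [[y A]|no].
  case/and4P => /= AF yA zA sF; set G := compress y z F.
  have cG : #|G| = #|F| by apply: card_compress.
  have sub : star z F \proper star z G.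
    apply/properP; split.
      apply/subsetP => B; rewrite !inE => /andP[BF zB]; rewrite zB BF /=.
      by case: (y \in B).
    exists (swap_set y z A); last by rewrite in_set (negPf sF).
    by rewrite in_set in_compress mem_swap_setl mem_swap_setr swap_setK AF yA zA orbT.
  have lt := proper_card sub.
  have le : #|star z G| <= #|F|.
    by rewrite -cG; apply: subset_leq_card; apply/subsetP => B; rewrite inE => /andP[].
  case: (IH G); first by move: lem lt le; rewrite cG; lia.
  move=> H [cH sH uH stH prop]; exists H; split => //.
  - by rewrite cH.
  - apply: leq_trans sH _; rewrite -(card_compress y z (shadow F)).
    exact: subset_leq_card (shadow_compress _ _ _).
  - move=> k hk; apply: uH => B; rewrite inE.
    case: ifP => _; first by case/orP => /hk //; rewrite card_swap_set.
    by case: ifP => _; [case/andP => /hk|move/hk].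
  - by apply: leq_trans (ltnW lt) stH.
exists F; split=> // y A AF yA zA; move: (no (y, A)); rewrite /= AF yA zA /=.
by move/negbFE.
Qed.

(** Frankl's argument: once no compression towards [z] changes the family, the
    shadow of the sets avoiding [z] lies in the link of [z]. *)
Lemma compressed_shadow z F :
    (forall y A, A \in F -> y \in A -> z \notin A -> swap_set y z A \in F) ->
  (#|shadow (deletion z F)| <= #|link z F|) &&
  (#|link z F| + #|shadow (link z F)| <= #|shadow F|).
Proof.
move=> stab; apply/andP; split.
  apply: subset_leq_card; apply/subsetP => B /shadowP[y yB].
  rewrite !inE negb_or => /andP[yF /andP[zy zB]]; rewrite zB /=.
  have := stab y (y |: B) yF; rewrite !inE eqxx negb_or zy zB => /(_ isT isT).
  suff -> : swap_set y z (y |: B) = z |: B by [].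
  apply/setP => u; rewrite !inE /swap (eq_sym u y).
  case: (eqVneq y u) => [<-|uy] /=.
    by rewrite (negPf zB) (negPf yB) [y == z]eq_sym (negPf zy).
  case: (eqVneq u z) => [->|uz] /=; first by rewrite eqxx.
  by rewrite eq_sym (negPf uy).
rewrite -(cardsID [set A : {set T} | z \in A] (shadow F)) addnC leq_add //.
  rewrite -(card_in_imset (D := mem (shadow (link z F))) (f := fun B => z |: B)) /=; last first.
    have zn B : B \in shadow (link z F) -> z \notin B.
      by case/shadowP => x _; rewrite !inE negb_or => /andP[/andP[]].
    by move=> B C /zn zB /zn zC E; rewrite -(setU1K zB) -(setU1K zC) E.
  apply: subset_leq_card; apply/subsetP => _ /imsetP[B /shadowP[x xB] + ->].
  rewrite !inE negb_or eqxx => /andP[/andP[zx zB] xF]; rewrite andbT.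
  apply/existsP; exists x; rewrite !inE negb_or eq_sym zx xB /=.
  by rewrite setUCA.
apply: subset_leq_card; apply/subsetP => B; rewrite !inE => /andP[zB BF].
by rewrite zB /=; apply/existsP; exists z; rewrite zB.
Qed.

(** The Kruskal-Katona theorem with the bound [s] left open.  After compression
    towards [z], the shadow contains the link of [z] together with the shadow of
    the link joined to [z], while the link contains the shadow of the deletion;
    with [a] the size of the link this is the recursive inequality required of
    [s].  The limits [K] and [M] allow a concrete [s] to be checked by
    computation. *)
Lemma shadow_bound (s : nat -> nat -> nat) (K M : nat) :
    (forall k, s k 0 = 0) -> (forall N, s 0 N = 0) ->
    (forall k N a, k < K -> N <= M -> 0 < a <= N -> s k.+1 (N - a) <= a ->
       s k.+1 N <= a + s k a) ->
  forall k F, k <= K -> #|F| <= M -> {in F, forall A, #|A| = k} ->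
  s k #|F| <= #|shadow F|.
Proof.
move=> s0 s0' srec k F; have [m] := ubnP (k + #|F|).
elim: m k F => // m IH k F lem kK FM cF.
case: (eqVneq #|F| 0) => [->|F0]; first by rewrite s0.
case: k lem kK cF => [|k] lem kK cF; first by rewrite s0'.
have /card_gt0P[A AF] : 0 < #|F| by rewrite lt0n.
have /card_gt0P[z zA] : 0 < #|A| by rewrite cF.
have [G [cG sG uG stG prop]] := exists_compressed z F.
apply: leq_trans sG; rewrite -cG in FM lem F0 *.
have {uG}/(_ _ cF) cGk := uG.
have /andP[h1 h2] := compressed_shadow prop.
have lk : 0 < #|link z G|.
  rewrite card_link; apply: leq_trans stG; apply/card_gt0P.
  by exists A; rewrite inE AF.
have spl := card_link_deletion z G.
have le1 : s k #|link z G| <= #|shadow (link z G)|.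
  apply: IH; try lia.
  move=> B; rewrite inE => /andP[zB /cGk]; rewrite cardsU1 zB; lia.
have le2 : s k.+1 #|deletion z G| <= #|shadow (deletion z G)|.
  apply: IH; try lia.
  by move=> B; rewrite inE => /andP[/cGk].
apply: leq_trans (srec k _ #|link z G| kK FM _ _) _; try lia.
by rewrite (_ : #|G| - _ = #|deletion z G|); lia.
Qed.

End Shadow.

(** * Face numbers of complexes on at most seven vertices *)

(** The coefficient of [t^k] in [t^j (1 - t)^(d - j)], for [j <= k <= d]. *)
Definition beta_coef (d k j : nat) : int :=
  if odd (k - j) then (- (Posz 'C(d - j, k - j)))%R else Posz 'C(d - j, k - j).

(* The largest [a] with ['C(a, k) <= N]. *)
Definition cascade_top k N := find (fun a => N < 'C(a.+1, k)) (iota 0 (N + k)).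

(** The Kruskal-Katona bound: write [N] greedily as
    ['C(a_k, k) + 'C(a_(k-1), k-1) + ...] and lower the second index of every
    binomial by one. *)
Fixpoint cascade k N :=
  if k is k'.+1 then
    if N is 0 then 0
    else 'C(cascade_top k N, k') + cascade k' (N - 'C(cascade_top k N, k))
  else 0.

Lemma all_iotaP (P : pred nat) m k :
  reflect (forall i, m <= i < m + k -> P i) (all P (iota m k)).
Proof.
by apply: (iffP allP) => h i; [rewrite -mem_iota | rewrite mem_iota]; apply: h.
Qed.

(** The largest families needed have ['C(7, 3) = 35] members. *)
Lemma cascade_rec k N a : k < 7 -> N <= 35 -> 0 < a <= N ->
  cascade k.+1 (N - a) <= a -> cascade k.+1 N <= a + cascade k a.
Proof.
move=> k7 N35 /andP[a0 aN].
have: all (fun k => all (fun N => all (fun a =>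
    (cascade k.+1 (N - a) <= a) ==> (cascade k.+1 N <= a + cascade k a))
  (iota 1 N)) (iota 0 36)) (iota 0 7).
  by vm_compute.
move/all_iotaP => /(_ k k7)/all_iotaP/(_ N N35)/all_iotaP/(_ a).
by rewrite a0 add1n ltnS aN => /(_ isT)/implyP.
Qed.

(** The numbers [beta] as a function of the list of face numbers, in a form that
    evaluates. *)
Definition list_beta d (s : seq nat) k : int :=
  foldr (fun j x => (beta_coef d k j * Posz (nth 0 s j) + x)%R) 0%R (iota 0 k.+1).

(** Extends the list [s] of face numbers by [m] further entries in all ways
    compatible with the Kruskal-Katona bound and with nonnegativity of the next
    [beta], and compares the completed lists with that of the full simplex. *)
Fixpoint check_fvec m n d (s : seq nat) : bool :=
  if m is m'.+1 then
    all (fun a => if cascade (size s) a <= last 0 s then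
                    if (0 <= list_beta d (rcons s a) (size s))%R
                    then check_fvec m' n d (rcons s a) else true
                  else true) (iota 0 'C(n, size s).+1)
  else all (fun k => (list_beta d s k <= list_beta d (mkseq (binomial n) d.+1) k)%R)
           (iota 0 d.+1).

Lemma check_fvec7 n d : n <= 7 -> 0 < d <= n -> check_fvec d n d [:: 1].
Proof.
move=> n7 /andP[d0 dn].
have: all (fun n => all (fun d => check_fvec d n d [:: 1]) (iota 1 n)) (iota 0 8).
  by vm_compute.
move/all_iotaP => /(_ n n7)/all_iotaP/(_ d).
by rewrite d0 add1n ltnS dn; apply.
Qed.

Lemma list_betaE d s k :
  list_beta d s k = (\sum_(j < k.+1) beta_coef d k j * Posz (nth 0 s j))%R.
Proof.
rewrite -(big_mkord xpredT (fun j => beta_coef d k j * Posz (nth 0 s j))%R).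
by rewrite unlock /list_beta /index_iota subn0; elim: (iota 0 k.+1) => //= i r ->.
Qed.

Lemma eq_list_beta d s t k :
  (forall j, j <= k -> nth 0 s j = nth 0 t j) -> list_beta d s k = list_beta d t k.
Proof.
by move=> st; rewrite !list_betaE; apply: eq_bigr => j _; rewrite st // -ltnS.
Qed.

Lemma check_fvecP n d (f : nat -> nat) m l : m + l = d.+1 -> 0 < l ->
    (forall j, f j <= 'C(n, j)) ->
    (forall j, j < d -> cascade j.+1 (f j.+1) <= f j) ->
    (forall k, k <= d -> (0 <= list_beta d (mkseq f d.+1) k)%R) ->
    check_fvec m n d (mkseq f l) ->
  forall k, k <= d ->
    (list_beta d (mkseq f d.+1) k <= list_beta d (mkseq (binomial n) d.+1) k)%R.
Proof.
move=> ml l0 fC fK fb; elim: m l ml l0 => [|m IH] l ml l0.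
  move/all_iotaP => h k kd; move: (h k kd).
  by have -> : d.+1 = l by lia.
have ls : mkseq f l.+1 = rcons (mkseq f l) (f l) by rewrite /mkseq -addn1 iotaD map_cat cats1.
move/all_iotaP/(_ (f l)).
rewrite size_mkseq add0n ltnS fC => /(_ isT).
have -> : last 0 (mkseq f l) = f l.-1.
  by rewrite -nth_last size_mkseq nth_mkseq // ltn_predL.
have -> : cascade l (f l) <= f l.-1.
  by rewrite -{1 2}(prednK l0) fK //; lia.
rewrite -ls (@eq_list_beta d _ (mkseq f d.+1)); last first.
  by move=> j jl; rewrite !nth_mkseq //; lia.
rewrite fb; last by lia.
by apply: IH; lia.
Qed.

Section Faces.
Variable n : nat.
Implicit Types (F : {set {set 'I_n}}).

(** The coefficients of degree [k <= d] of [(1 - t)^d H(t)], where [H] is the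
    series [\sum_(A in F) (t / (1 - t))^|A|] which counts the monomials with
    support in [F]. *)
Definition beta d F k : int := (\sum_(A in F | (#|A| <= k)%N) beta_coef d k #|A|)%R.

Definition fvec F j := #|[set A in F | #|A| == j]|.

Lemma betaE d F k : k <= d -> beta d F k = list_beta d (mkseq (fvec F) d.+1) k.
Proof.
move=> kd; rewrite list_betaE /beta.
rewrite (partition_big (fun A : {set 'I_n} => inord #|A| : 'I_k.+1) predT) //=.
apply: eq_bigr => j _; rewrite nth_mkseq; last by case: j => j /=; lia.
pose Fj := [set A in F | #|A| == j].
rewrite (eq_bigl (mem Fj)) => [|A]; last first.
  rewrite /= inE -andbA; case: (A \in F) => //=.
  apply/andP/eqP => [[Ak /eqP <-]|Aj]; first by rewrite inordK.
  by rewrite -ltnS Aj; split=> //; apply/eqP/val_inj; rewrite /= inordK.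
rewrite (eq_bigr (fun=> beta_coef d k j)) => [|A]; last by rewrite /= in_set => /andP[_ /eqP->].
by rewrite sumr_const -mulr_natr natz.
Qed.

Lemma fvec_shadow F j : (forall A B : {set 'I_n}, A \in F -> B \subset A -> B \in F) ->
  n <= 7 -> j < 7 -> cascade j.+1 (fvec F j.+1) <= fvec F j.
Proof.
move=> dF n7 j7; have c0 k : cascade k 0 = 0 by case: k.
have fle k : fvec F k <= 'C(n, k).
  rewrite -[n in 'C(n, _)]card_ord -cardsT -cards_draws; apply: subset_leq_card.
  by apply/subsetP => A; rewrite !inE subsetT => /andP[].
have c35 : 'C(n, j.+1) <= 35.
  have: all (fun n => all (fun j => 'C(n, j.+1) <= 35) (iota 0 7)) (iota 0 8).
    by vm_compute.
  by move/all_iotaP => /(_ n n7)/all_iotaP/(_ j j7).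
apply: leq_trans (_ : #|shadow [set A in F | #|A| == j.+1]| <= _).
  apply: (shadow_bound c0 _ cascade_rec) => //.
    exact: leq_trans (fle _) c35.
  by move=> A; rewrite inE => /andP[_ /eqP].
apply: subset_leq_card; apply/subsetP => B /shadowP[x xB].
rewrite !inE cardsU1 xB eqSS => /andP[/dF hB ->].
by rewrite hB // subsetUr.
Qed.

Lemma betaC d F k : (beta d (~: F) k = beta d [set: {set 'I_n}] k - beta d F k)%R.
Proof.
apply/eqP; rewrite -subr_eq0 opprB addrA subr_eq0; apply/eqP; symmetry.
rewrite /beta (bigID (mem F)) /= addrC; congr (_ + _)%R.
  by apply: eq_bigl => A; rewrite !inE andbC.
by apply: eq_bigl => A; rewrite !inE andbC.
Qed.

(** By [betaC] the claim says that the [beta] of the faces do not exceed those of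
    the full simplex. *)
Lemma beta_complement d F : (forall A B : {set 'I_n}, A \in F -> B \subset A -> B \in F) ->
    set0 \in F -> n <= 7 -> 0 < d <= n ->
    (forall k, (k <= d)%N -> 0 <= beta d F k)%R ->
  forall k, k <= d -> (0 <= beta d (~: F) k)%R.
Proof.
move=> dF F0 n7 dn bF k kd; rewrite betaC subr_ge0 !betaE //.
have fT : mkseq (fvec [set: {set 'I_n}]) d.+1 = mkseq (binomial n) d.+1.
  apply: eq_mkseq => j; rewrite /fvec -[n in 'C(n, _)]card_ord -cardsT -cards_draws.
  by apply: eq_card => A; rewrite !inE subsetT.
rewrite fT; apply: (@check_fvecP n d (fvec F) d 1) => //.
- by rewrite addn1.
- move=> j; rewrite -[n in 'C(n, _)]card_ord -cardsT -cards_draws; apply: subset_leq_card.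
  by apply/subsetP => A; rewrite !inE subsetT => /andP[].
- by move=> j jd; apply: fvec_shadow => //; lia.
- by move=> i id; rewrite -betaE // bF.
- suff -> : mkseq (fvec F) 1 = [:: 1] by apply: check_fvec7.
  rewrite /mkseq /= /fvec; congr [:: _]; apply/eqP/cards1P; exists set0.
  by apply/setP => A; rewrite !inE cards_eq0; case: eqP => [->|]; rewrite ?F0 // andbF.
Qed.

End Faces.

Local Open Scope ring_scope.

(** * Regular sequences and generic linear forms *)

Section Submodules.
Variables (R : comNzRingType) (F : lmodType R).
Implicit Types (B : F -> Prop) (f g : R) (fs : seq R).

Record submod B : Prop := Submod {
  submod0 : B 0;
  submodD : forall u v, B u -> B v -> B (u + v);
  submodZ : forall a v, B v -> B (a *: v) }.

Lemma submodN B v : submod B -> B v -> B (- v).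
Proof. by move=> sB Bv; rewrite -scaleN1r; apply: submodZ. Qed.

Lemma submodB B u v : submod B -> B u -> B v -> B (u - v).
Proof. by move=> sB Bu Bv; apply: submodD => //; apply: submodN. Qed.

Lemma submod_sum B I (r : seq I) (P : pred I) (v : I -> F) :
  submod B -> (forall i, P i -> B (v i)) -> B (\sum_(i <- r | P i) v i).
Proof. by case=> h0 hD _; apply: big_ind. Qed.

(** The submodule [B + f F]. *)
Definition adjoin f B : F -> Prop := fun v => exists w, B (v - f *: w).

Definition nonzerodiv f B := forall v, B (f *: v) -> B v.

(** Regular sequences on [F / B].  Working with submodules of a fixed free module
    [F] avoids quotients, which would pile up when variables are adjoined. *)
Fixpoint regular B fs :=
  if fs is f :: fs' then nonzerodiv f B /\ regular (adjoin f B) fs' else True.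

Lemma submod_adjoin f B : submod B -> submod (adjoin f B).
Proof.
move=> sB; split.
- by exists 0; rewrite scaler0 subr0; apply: submod0.
- move=> u v [u' hu] [v' hv]; exists (u' + v').
  by rewrite scalerDr opprD addrACA; apply: submodD.
- move=> a v [w hw]; exists (a *: w).
  by rewrite scalerA mulrC -scalerA -scalerBr; apply: submodZ.
Qed.

Lemma sub_adjoin f B v : B v -> adjoin f B v.
Proof. by exists 0; rewrite scaler0 subr0. Qed.

Lemma adjoinC f g B : adjoin f (adjoin g B) = adjoin g (adjoin f B).
Proof.
by apply/funext => v; apply/propext; split=> -[w [w' h]]; exists w', w;
  rewrite addrAC.
Qed.

(** Half of the exchange of two elements of a regular sequence: modulo [B], an
    equation [f v = g w] puts [w] into [fF], say [w = f w'], and cancelling [f]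
    gives [v = g w']. *)
Lemma nonzerodiv_exchange f g B : submod B ->
  nonzerodiv f B -> nonzerodiv g (adjoin f B) -> nonzerodiv f (adjoin g B).
Proof.
move=> sB ff fg v [w hw].
have [w' hw'] : adjoin f B w.
  apply: fg; exists v; rewrite -opprB; exact: submodN.
exists w'; apply: ff.
have -> : f *: (v - g *: w') = (f *: v - g *: w) + g *: (w - f *: w').
  by rewrite !scalerBr !scalerA [g * f]mulrC addrA subrK.
by apply: submodD => //; apply: submodZ.
Qed.

End Submodules.

Section PolyRows.
Variables (R : comNzRingType) (s : nat).
Local Notation F := 'rV[R]_s.
Local Notation F' := 'rV[{poly R}]_s.

Definition coefr k (v : F') : F := \row_i (v 0 i)`_k.

Lemma coefrP (u v : F') : (forall k, coefr k u = coefr k v) <-> u = v.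
Proof.
split=> [h|->] //; apply/rowP => i; apply/polyP => k.
by have /rowP/(_ i) := h k; rewrite !mxE.
Qed.

Lemma coefr0 k : coefr k 0 = 0.
Proof. by apply/rowP => i; rewrite !mxE coef0. Qed.

Lemma coefrD k : {morph coefr k : u v / u + v}.
Proof. by move=> u v; apply/rowP => i; rewrite !mxE coefD. Qed.

Lemma coefrN k : {morph coefr k : u / - u}.
Proof. by move=> u; apply/rowP => i; rewrite !mxE coefN. Qed.

Lemma coefrB k : {morph coefr k : u v / u - v}.
Proof. by move=> u v; rewrite coefrD coefrN. Qed.

Lemma coefr_sum k I (r : seq I) (P : pred I) (v : I -> F') :
  coefr k (\sum_(i <- r | P i) v i) = \sum_(i <- r | P i) coefr k (v i).
Proof. exact: (big_morph _ (@coefrD k) (coefr0 k)). Qed.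

Lemma coefrZ k p v : coefr k (p *: v) = \sum_(i < k.+1) p`_i *: coefr (k - i) v.
Proof.
apply/rowP => i; rewrite !mxE coefM summxE; apply: eq_bigr => j _.
by rewrite !mxE.
Qed.

Lemma coefrC k c v : coefr k (c%:P *: v) = c *: coefr k v.
Proof. by apply/rowP => i; rewrite !mxE coefCM. Qed.

Lemma coefr_bound v : exists m, forall k, (m <= k)%N -> coefr k v = 0.
Proof.
exists (\max_i size (v 0%R i))%N => k mk; apply/rowP => i; rewrite !mxE.
by rewrite nth_default // (leq_trans _ mk) // (leq_bigmax i).
Qed.

(* The row [\sum_(k < m) u^k f k]. *)
Definition rowpoly m (f : nat -> F) : F' := \row_i \poly_(k < m) f k 0 i.

Lemma coefr_rowpoly m f k : coefr k (rowpoly m f) = if (k < m)%N then f k else 0.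
Proof. by apply/rowP => i; rewrite !mxE coef_poly; case: ifP; rewrite ?mxE. Qed.

Lemma coefr_const k (v : F) : coefr k (map_mx polyC v) = if k == 0%N then v else 0.
Proof. by apply/rowP => i; rewrite !mxE coefC; case: ifP; rewrite ?mxE. Qed.

(** The submodule [B[u]] of [F[u]]. *)
Definition polysub (B : F -> Prop) : F' -> Prop := fun v => forall k, B (coefr k v).

Lemma submod_polysub B : submod B -> submod (polysub B).
Proof.
move=> sB; split.
- by move=> k; rewrite coefr0; apply: submod0.
- by move=> u v hu hv k; rewrite coefrD; apply: submodD.
- move=> a v hv k; rewrite coefrZ; apply: submod_sum => // i _; exact: submodZ.
Qed.

Lemma polysub_adjoin f B :
  submod B -> polysub (adjoin f B) = adjoin f%:P (polysub B).
Proof.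
move=> sB; apply/funext => v; apply/propext; split; last first.
  by move=> [w hw] k; exists (coefr k w); rewrite -coefrC -coefrB.
move=> h; have [w hw] := choice h; have [m hm] := coefr_bound v.
exists (rowpoly m w) => k; rewrite coefrB coefrC coefr_rowpoly.
case: ltnP => [//|mk]; rewrite hm // scaler0 subr0; exact: submod0.
Qed.

Lemma nonzerodiv_polysub f B : nonzerodiv f B -> nonzerodiv f%:P (polysub B).
Proof. by move=> ff v h k; apply: ff; rewrite -coefrC. Qed.

Definition in_ideal (xs : seq R) f :=
  exists g : nat -> R, f = \sum_(l < size xs) g l * xs`_l.

(** McCoy's argument, with [Poly xs] as the generic linear form
    [\sum_l u^l x_l].  If it kills a nonzero [v] of [F[u] / B[u]] and some
    [x_l v] is nonzero, then for the largest such [l] the product [x_l v] has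
    smaller degree and is killed too.  A [v] of minimal degree is thus killed
    by all the [x_l], hence by [f]. *)
Lemma nonzerodiv_generic (xs : seq R) (f : R) B : submod B ->
    in_ideal xs f -> nonzerodiv f B ->
  nonzerodiv (Poly xs) (polysub B).
Proof.
move=> sB [g fE] ff v.
have sB' := submod_polysub sB.
suff key m : forall v, (forall k, (m <= k)%N -> B (coefr k v)) ->
    polysub B (Poly xs *: v) -> polysub B v.
  have [m hm] := coefr_bound v; apply: (key m) => k mk.
  rewrite hm //; exact: submod0.
elim: m => [|m IH] {}v hv hY; first by move=> k; apply: hv.
suff xv l : polysub B ((xs`_l)%:P *: v).
  move=> k; apply: ff; rewrite fE scaler_suml; apply: submod_sum => // l _.
  by rewrite -scalerA; apply: submodZ => //; rewrite -coefrC; apply: xv.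
(* Downward induction on [l]: up to terms in [B], the coefficient of degree
   [l + m] of [Poly xs *: v] is the product of [x_l] by the top coefficient. *)
have [p] := ubnP (size xs - l)%N; elim: p l => // p IHp l lp.
apply: IH; last first.
  rewrite scalerA mulrC -scalerA; exact: (submodZ sB').
move=> k mk; rewrite coefrC.
case: (ltngtP m k) mk => // [mk _|<- _]; first by apply: submodZ => //; apply: hv.
have := hY (l + m)%N; rewrite coefrZ.
have lt : (l < (l + m).+1)%N by lia.
rewrite (bigD1 (Ordinal lt)) //= addKn coef_Poly => h.
set S := \sum_(i < _ | _) _ in h.
suff BS : B S by have := submodB sB h BS; rewrite addrK.
apply: submod_sum => // i il; rewrite coef_Poly.
case: (ltngtP i l) => [il'|li|il'].
- by apply: submodZ => //; apply: hv; lia.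
- case: (leqP (size xs) i) => [si|is_]; first by rewrite nth_default // scale0r; apply: submod0.
  by rewrite -coefrC; apply: IHp; lia.
- by case/eqP: il; apply: val_inj.
Qed.

(** The generic linear form is a nonzero divisor modulo each [(f_1, ..., f_i)],
    [i < r], so that repeated exchanges move it from the last place of
    [f_1, ..., f_(r-1), Y] to the first one. *)
Lemma regular_generic (xs : seq R) f fs B : submod B ->
    (forall g, g \in f :: fs -> in_ideal xs g) -> regular B (f :: fs) ->
  regular (adjoin (Poly xs) (polysub B)) (map polyC (belast f fs)).
Proof.
elim: fs f B => [|g fs IH] f B sB hxs //= [ff [fg reg]].
split.
  apply: nonzerodiv_exchange; first exact: submod_polysub.
    exact: nonzerodiv_polysub.
  rewrite -polysub_adjoin //; apply: nonzerodiv_generic fg.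
    exact: submod_adjoin.
  by apply: hxs; rewrite !inE eqxx orbT.
rewrite adjoinC -polysub_adjoin //; apply: IH.
- exact: submod_adjoin.
- by move=> h hh; apply: hxs; rewrite inE hh orbT.
- by split.
Qed.

Lemma nonzerodiv_generic_head (xs : seq R) f fs B : submod B ->
    (forall g, g \in f :: fs -> in_ideal xs g) -> regular B (f :: fs) ->
  nonzerodiv (Poly xs) (polysub B).
Proof.
move=> sB hxs [ff _]; apply: nonzerodiv_generic ff => //.
by apply: hxs; rewrite mem_head.
Qed.

End PolyRows.

(** * Ranks over an integral domain *)

(** Padding [C] with zero columns gives a singular square matrix, and singular
    matrices over a domain have a nonzero kernel vector. *)
Lemma left_kernel (D : idomainType) (I J : finType) (C : I -> J -> D) :
  (#|J| < #|I|)%N ->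
  exists a : I -> D, (exists i, a i != 0) /\ forall j, \sum_i a i * C i j = 0.
Proof.
move=> lt.
pose A : 'M[D]_#|I| := \matrix_(i, j)
  if insub (j : nat) is Some k then C (enum_val i) (enum_val (k : 'I_#|J|)) else 0.
have /eqP : \det A = 0.
  apply/eqP; rewrite -det_tr; apply/det0P.
  exists (delta_mx 0 (Ordinal lt)).
    apply/negP => /eqP/rowP/(_ (Ordinal lt)); rewrite !mxE !eqxx => /eqP.
    by rewrite oner_eq0.
  apply/rowP => i; rewrite -rowE !mxE /=.
  by case: insubP => //= k; rewrite ltnn.
move/det0P => [v v0 vA]; exists (fun i => v 0 (enum_rank i)); split.
  have /rV0Pn[i vi] := v0; exists (enum_val i); by rewrite enum_valK.
move=> j; have jI : (enum_rank j < #|I|)%N by apply: ltn_trans lt.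
have /rowP/(_ (Ordinal jI)) := vA; rewrite !mxE; apply: etrans.
rewrite (reindex (@enum_val I I)) /=; last first.
  by exists enum_rank => i _; rewrite ?enum_valK ?enum_rankK.
apply: eq_bigr => i _; rewrite enum_valK mxE /= insubT //= => lj.
congr (_ * C _ _); rewrite -[LHS]enum_rankK; congr enum_val; exact: val_inj.
Qed.

Section Rank.
Variables (D : idomainType) (R : comNzRingType) (phi : {rmorphism D -> R}).
Variable F : lmodType R.
Implicit Types (B C G : F -> Prop).

(** Graded components are stable under the scalars [D] only. *)
Record dsubmod B : Prop := Dsubmod {
  dsubmod0 : B 0;
  dsubmodD : forall u v, B u -> B v -> B (u + v);
  dsubmodZ : forall d v, B v -> B (phi d *: v) }.

Lemma submod_dsubmod B : submod B -> dsubmod B.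
Proof. by case=> h0 hD hZ; split=> // d v; apply: hZ. Qed.

Lemma dsubmodB B u v : dsubmod B -> B u -> B v -> B (u - v).
Proof.
move=> sB Bu Bv; apply: dsubmodD => //.
by rewrite -scaleN1r -(rmorph1 phi) -rmorphN; apply: dsubmodZ.
Qed.

Lemma dsubmod_sum B I (r : seq I) (P : pred I) (v : I -> F) :
  dsubmod B -> (forall i, P i -> B (v i)) -> B (\sum_(i <- r | P i) v i).
Proof. by case=> h0 hD _; apply: big_ind. Qed.

Definition lincomb (I : finType) (c : I -> D) (e : I -> F) :=
  \sum_i phi (c i) *: e i.

Lemma dsubmod_lincomb B (I : finType) c (e : I -> F) :
  dsubmod B -> (forall i, B (e i)) -> B (lincomb c e).
Proof. by move=> sB Be; apply: dsubmod_sum => // i _; apply: dsubmodZ. Qed.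

Definition indep B (I : finType) (e : I -> F) :=
  forall c, B (lincomb c e) -> forall i, c i = 0.

(** [G] is generated by [e] modulo [B], up to [D]-torsion. *)
Definition torsion_gen G B (I : finType) (e : I -> F) :=
  forall g, G g -> exists d c, d != 0 /\ B (phi d *: g - lincomb c e).

(** The rank of [G] modulo [B]; [B] need not be contained in [G]. *)
Definition has_rank G B h := exists e : 'I_h -> F,
  [/\ forall i, G (e i), indep B e & torsion_gen G B e].

(** A relation between the coordinates of the [w j] is a relation between the
    [w j] themselves once the denominators [d j] are taken into account. *)
Lemma steinitz G B (I J : finType) (e : I -> F) (w : J -> F) : dsubmod B ->
  torsion_gen G B e -> (forall j, G (w j)) -> indep B w -> (#|J| <= #|I|)%N.
Proof.
move=> sB ge Gw iw; rewrite leqNgt; apply/negP => lt.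
have /choice[d /choice[c dc]] := fun j => ge _ (Gw j).
have [a [[j0 aj0] aC]] := left_kernel c lt.
suff /iw/(_ j0)/eqP : B (lincomb (fun j => a j * d j) w).
  by rewrite mulf_eq0 (negPf aj0) (negPf (dc j0).1).
have -> : lincomb (fun j => a j * d j) w =
          \sum_j phi (a j) *: (phi (d j) *: w j - lincomb (c j) e).
  rewrite (eq_bigr (fun j => phi (a j * d j) *: w j - phi (a j) *: lincomb (c j) e)).
    rewrite sumrB -[LHS]subr0; congr (_ - _); symmetry.
    under eq_bigr do rewrite scaler_sumr.
    rewrite exchange_big big1 //= => i _.
    under eq_bigr do rewrite scalerA -rmorphM.
    by rewrite -scaler_suml -rmorph_sum aC rmorph0 scale0r.
  by move=> j _; rewrite scalerBr scalerA rmorphM.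
by apply: dsubmod_sum => // j _; apply: dsubmodZ => //; case: (dc j).
Qed.

(** A maximal independent family exists because [steinitz] bounds the size of
    independent families. *)
Lemma has_rank_torsion_gen G C (I : finType) (e : I -> F) :
  dsubmod C -> torsion_gen G C e -> exists m, has_rank G C m.
Proof.
move=> sC ge.
pose P m := `[< exists w : 'I_m -> F, (forall i, G (w i)) /\ indep C w >].
have exP : exists m, P m.
  by exists 0%N; apply/asboolP; exists (fun=> 0); split; [case|move=> c _ []].
have ubP m : P m -> (m <= #|I|)%N.
  move=> /asboolP[w [Gw iw]]; rewrite -[m]card_ord.
  exact: steinitz ge Gw iw.
have [m /asboolP[w [Gw iw]] mmax] := ex_maxnP exP ubP.
exists m, w; split=> // g Gg.
pose w' (i : 'I_m.+1) := if unlift ord0 i is Some j then w j else g.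
have w'0 : w' ord0 = g by rewrite /w' unlift_none.
have w'l j : w' (lift ord0 j) = w j by rewrite /w' liftK.
have : ~ indep C w'.
  move=> iw'; have /mmax : P m.+1; last by rewrite ltnn.
  apply/asboolP; exists w'; split=> // i; rewrite /w'; by case: unliftP.
have [//|no] := pselect (exists d c, d != 0 /\ C (phi d *: g - lincomb c w)).
case=> c; rewrite /lincomb big_ord_recl w'0.
under eq_bigr do rewrite w'l.
move=> hC.
have c0 : c ord0 = 0.
  apply/eqP/negPn/negP => c0; apply: no.
  exists (c ord0), (fun j => - c (lift ord0 j)); split=> //.
  rewrite /lincomb; under eq_bigr do rewrite rmorphN scaleNr.
  by rewrite sumrN opprK.
move=> i; case: (unliftP ord0 i) => [j|] -> //.
apply: (iw (fun j => c (lift ord0 j))); move: hC.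
by rewrite c0 rmorph0 scale0r add0r.
Qed.

Lemma torsion_gen_sub G B C (I : finType) (e : I -> F) :
  (forall v, G v -> B v -> C v) -> dsubmod G -> (forall i, G (e i)) ->
  torsion_gen G B e -> torsion_gen G C e.
Proof.
move=> BC sG Ge ge g Gg; have [d [c [d0 h]]] := ge g Gg.
exists d, c; split=> //; apply: BC => //; apply: dsubmodB => //.
  exact: dsubmodZ.
exact: dsubmod_lincomb.
Qed.

Lemma has_rank_ext G B C h : dsubmod G -> (forall v, G v -> B v <-> C v) ->
  has_rank G B h -> has_rank G C h.
Proof.
move=> sG BC [e [Ge ie ge]]; exists e; split=> //.
  move=> c hc; apply: ie; apply/BC => //; exact: dsubmod_lincomb.
by apply: torsion_gen_sub ge => // v Gv /BC; apply.
Qed.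

(** Rank is additive on [0 -> C/B -> G/B -> G/C -> 0]. *)
Lemma has_rank_add G B C h l m : dsubmod B -> dsubmod C -> dsubmod G ->
    (forall v, C v -> G v) -> (forall v, G v -> B v -> C v) ->
    has_rank G B h -> has_rank C B l -> has_rank G C m ->
  h = (l + m)%N.
Proof.
move=> sB sC sG CG BC [f [Gf jf gf]] [e [Ce ie ge]] [w [Gw iw gw]].
pose ew (i : 'I_l + 'I_m) := match i with inl i => e i | inr i => w i end.
have ewE c : lincomb c ew = lincomb (fun i => c (inl i)) e + lincomb (fun i => c (inr i)) w.
  by rewrite /lincomb big_sumType.
have Gew i : G (ew i) by case: i => i //=; apply: CG.
have iew : indep B ew.
  move=> c hc; have := hc; rewrite ewE => hc'.
  have Ce' : C (lincomb (fun i => c (inl i)) e) by apply: dsubmod_lincomb.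
  have cr : forall i, c (inr i) = 0.
    apply: (iw (fun i => c (inr i))).
    rewrite -[lincomb _ w](addKr (lincomb (fun i => c (inl i)) e)) addrC.
    apply: dsubmodB => //; apply: BC => //; rewrite -ewE; exact: dsubmod_lincomb.
  have cl : forall i, c (inl i) = 0.
    apply: (ie (fun i => c (inl i))); move: hc'.
    rewrite [X in _ + X]big1 ?addr0 // => i _; by rewrite cr rmorph0 scale0r.
  by case.
have gew : torsion_gen G B ew.
  move=> g Gg; have [d [c [d0 h1]]] := gw g Gg.
  have [d' [c' [d'0 h2]]] := ge _ h1.
  exists (d' * d), (fun i => match i with inl i => c' i | inr i => d' * c i end).
  split; first by rewrite mulf_neq0.
  move: h2; rewrite ewE scalerBr scalerA -rmorphM opprD addrAC addrA; congr (B (_ - _)).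
  by rewrite /lincomb scaler_sumr; apply: eq_bigr => i _; rewrite scalerA rmorphM.
have le1 := steinitz sB gf Gew iew; have le2 := steinitz sB gew Gf jf.
by move: le1 le2; rewrite card_sum !card_ord; lia.
Qed.

(** Multiplication by a nonzero divisor embeds [G0 / B] into [G / B], and
    embeddings preserve ranks. *)
Lemma has_rank_mul G0 G B y l : submod B -> dsubmod G0 ->
    nonzerodiv y B -> (forall w, G0 w -> G (y *: w)) ->
    has_rank G0 B l ->
  has_rank (fun v => G v /\ exists2 w, G0 w & B (v - y *: w)) B l.
Proof.
move=> sB sG0 yB yG [e [Ge ie ge]].
have lE c : lincomb c (fun i => y *: e i) = y *: lincomb c e.
  rewrite /lincomb scaler_sumr; apply: eq_bigr => i _.
  by rewrite !scalerA mulrC.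
exists (fun i => y *: e i); split.
- by move=> i; split; [apply: yG|exists (e i); rewrite ?subrr //; apply: submod0].
- by move=> c; rewrite lE => /yB; apply: ie.
- move=> v [Gv [w Gw hw]]; have [d [c [d0 h]]] := ge w Gw.
  exists d, c; split=> //; rewrite lE.
  have -> : phi d *: v - y *: lincomb c e =
            phi d *: (v - y *: w) + y *: (phi d *: w - lincomb c e).
    by rewrite !scalerBr !scalerA [y * _]mulrC addrA subrK.
  by apply: submodD => //; apply: submodZ.
Qed.

End Rank.

Section RankPoly.
Variables (D : idomainType) (R : comNzRingType) (phi : {rmorphism D -> R}).
Variable s : nat.
Implicit Types (B C G : 'rV[R]_s -> Prop).

Lemma coefr_scale k (p : {poly R}) (e : 'rV[R]_s) :
  coefr k (p *: map_mx polyC e) = p`_k *: e.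
Proof. by apply/rowP => i; rewrite !mxE coefMC. Qed.

Lemma coefr_lincomb (I : finType) (c : I -> {poly D}) (e : I -> 'rV[R]_s) k :
  coefr k (lincomb (map_poly phi) c (fun i => map_mx polyC (e i))) =
  lincomb phi (fun i => (c i)`_k) e.
Proof.
rewrite coefr_sum; apply: eq_bigr => i _.
by rewrite coefr_scale coef_map.
Qed.

Lemma dsubmod_polysub G : dsubmod phi G -> dsubmod (map_poly phi) (polysub G).
Proof.
move=> sG; split.
- by move=> k; rewrite coefr0; apply: dsubmod0 sG.
- by move=> u v hu hv k; rewrite coefrD; apply: (dsubmodD sG).
- move=> d v hv k; rewrite coefrZ; apply: (dsubmod_sum (B := G) (phi := phi)) => // i _.
  by rewrite coef_map; apply: (dsubmodZ sG).
Qed.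

(** A basis of [G / B] over [D] up to torsion is also one of [G[u] / B[u]] over
    [D[u]]; a common denominator of the finitely many coefficients of a
    polynomial is the product of their denominators. *)
Lemma has_rank_polysub G B h : dsubmod phi G -> dsubmod phi B ->
  has_rank phi G B h -> has_rank (map_poly phi) (polysub G) (polysub B) h.
Proof.
move=> sG sB [e [Ge ie ge]]; exists (fun i => map_mx polyC (e i)); split.
- move=> i k; rewrite coefr_const; case: eqP => // _; exact: dsubmod0 sG.
- move=> c hc i; apply/polyP => k; rewrite coef0.
  by apply: (ie (fun i => (c i)`_k)); rewrite -coefr_lincomb.
move=> g Gg; have [m hm] := coefr_bound g.
have : forall k, exists (d : D) (c : 'I_h -> D),
    d != 0 /\ B (phi d *: coefr k g - lincomb phi c e) by move=> k; apply: ge.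
move=> /choice[d /choice[c dc]].
have phiC a : map_poly phi a%:P = (phi a)%:P by exact: map_polyC.
pose q k := \prod_(l < m | l != k :> nat) d l.
have qE k : (k < m)%N -> \prod_(l < m) d l = q k * d k.
  by move=> km; rewrite (bigD1 (Ordinal km)) //= mulrC.
exists (\prod_(l < m) d l)%:P, (fun i => \poly_(k < m) (q k * c k i)); split.
  by rewrite polyC_eq0; apply/prodf_neq0 => l _; case: (dc l).
move=> k; rewrite coefrB coefr_lincomb /= phiC coefrC.
case: (ltnP k m) => km; last first.
  rewrite hm // scaler0 sub0r /lincomb big1 ?oppr0; first exact: dsubmod0 sB.
  by move=> i _; rewrite coef_poly ltnNge km rmorph0 scale0r.
rewrite (_ : lincomb _ _ _ = phi (q k) *: lincomb phi (c k) e).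
  rewrite (qE _ km)  rmorphM -scalerA -scalerBr.
  by apply: dsubmodZ; case: (dc k).
rewrite /lincomb scaler_sumr; apply: eq_bigr => i _.
by rewrite coef_poly km rmorphM scalerA.
Qed.

End RankPoly.

(** * Differences of the Hilbert function *)

Definition delta (f : int -> int) (j : int) : int := f j - f (j - 1).

(** A graded module [F / B] with components of rank [h j] over [D].  The grading
    is given by projections [pr j] of [F] which preserve [B], so that its
    components are the images [pr j v = v] and a relation modulo [B] can be
    cut down to one degree. *)
Record graded_quot (D : idomainType) (R : comNzRingType) (phi : {rmorphism D -> R})
    (s : nat) (xs : seq R) (B : 'rV[R]_s -> Prop) (pr : int -> 'rV[R]_s -> 'rV[R]_s)
    (h : int -> nat) : Prop := GradedQuot {
  gq_sub : submod B;
  gq_prD : forall j u v, pr j (u + v) = pr j u + pr j v;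
  gq_prZ : forall j d v, pr j (phi d *: v) = phi d *: pr j v;
  gq_prK : forall j v, pr j (pr j v) = pr j v;
  gq_prX : forall j x v, x \in xs -> pr j (x *: v) = x *: pr (j - 1) v;
  gq_prB : forall j v, B v -> B (pr j v);
  gq_rank : forall j, has_rank phi (fun v => pr j v = v) B (h j) }.

Section GenericStep.
Variables (D : idomainType) (R : comNzRingType) (phi : {rmorphism D -> R}).
Variables (s : nat) (xs : seq R) (B : 'rV[R]_s -> Prop).
Variables (pr : int -> 'rV[R]_s -> 'rV[R]_s) (h : int -> nat).
Hypothesis gq : graded_quot phi xs B pr h.

Let sB := gq_sub gq.

Let pr0 j : pr j 0 = 0.
Proof. by apply: (addrI (pr j 0)); rewrite -(gq_prD gq) !addr0. Qed.

Let pr_sum j I (r : seq I) (P : pred I) (v : I -> 'rV[R]_s) :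
  pr j (\sum_(i <- r | P i) v i) = \sum_(i <- r | P i) pr j (v i).
Proof. exact: (big_morph _ (gq_prD gq j) (pr0 j)). Qed.

Definition pr_poly j (v : 'rV[{poly R}]_s) : 'rV[{poly R}]_s :=
  rowpoly (\max_i size (v 0%R i))%N (fun k => pr j (coefr k v)).

Lemma coefr_pr_poly j v k : coefr k (pr_poly j v) = pr j (coefr k v).
Proof.
rewrite coefr_rowpoly; case: ltnP => // le; rewrite (_ : coefr k v = 0) ?pr0 //.
by apply/rowP => i; rewrite !mxE nth_default // (leq_trans _ le) // (leq_bigmax i).
Qed.

Lemma pr_polyP j : (fun v => pr_poly j v = v) = polysub (fun v => pr j v = v).
Proof.
apply/funext => v; apply/propext; rewrite -coefrP.
by split=> hv k; [rewrite -coefr_pr_poly | rewrite coefr_pr_poly].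
Qed.

Lemma dsubmod_pr j : dsubmod phi (fun v => pr j v = v).
Proof.
split=> [|u v hu hv|d v hv]; first exact: pr0.
  by rewrite (gq_prD gq) hu hv.
by rewrite (gq_prZ gq) hv.
Qed.

Lemma pr_poly_generic j v : pr_poly j (Poly xs *: v) = Poly xs *: pr_poly (j - 1) v.
Proof.
apply/coefrP => k; rewrite coefr_pr_poly !coefrZ pr_sum; apply: eq_bigr => i _.
rewrite coefr_pr_poly coef_Poly; case: (ltnP i (size xs)) => ixs.
  by rewrite (gq_prX gq) // mem_nth.
by rewrite nth_default // !scale0r pr0.
Qed.

Lemma pr_polyB j v : polysub B v -> polysub B (pr_poly j v).
Proof. by move=> hv k; rewrite coefr_pr_poly; apply: (gq_prB gq). Qed.

Lemma pr_polyD j u v : pr_poly j (u + v) = pr_poly j u + pr_poly j v.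
Proof. by apply/coefrP => k; rewrite coefrD !coefr_pr_poly coefrD (gq_prD gq). Qed.

Lemma pr_poly_sub j u v : pr_poly j (u - v) = pr_poly j u - pr_poly j v.
Proof. by rewrite -[u in RHS](subrK v) (pr_polyD j (u - v)) addrK. Qed.

(** The exact sequence [0 -> N(-1)[u] -> N[u] -> N[u] / Y N[u] -> 0] computes the
    ranks of the components.  The projections are needed to see that a multiple
    [Y w] of degree [j] modulo [B[u]] is a multiple of an element of degree
    [j - 1]. *)
Lemma graded_quot_generic : nonzerodiv (Poly xs) (polysub B) ->
  exists2 h' : int -> nat,
    graded_quot (map_poly phi) (map polyC xs) (adjoin (Poly xs) (polysub B)) pr_poly h'
  & forall j, (h' j)%:Z = delta (fun i => (h i)%:Z) j.
Proof.
move=> YB; set Y := Poly xs; set B' := polysub B; pose phi' := map_poly phi.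
have sB' : submod B' := submod_polysub sB.
have sBY : submod (adjoin Y B') := submod_adjoin _ sB'.
have sG j : dsubmod phi' (fun v => pr_poly j v = v).
  by rewrite pr_polyP; apply/dsubmod_polysub/dsubmod_pr.
have rk j : has_rank phi' (fun v => pr_poly j v = v) B' (h j).
  rewrite pr_polyP; apply: has_rank_polysub (gq_rank gq j); last exact: submod_dsubmod.
  exact: dsubmod_pr.
have YG j w : pr_poly (j - 1) w = w -> pr_poly j (Y *: w) = Y *: w.
  by move=> hw; rewrite pr_poly_generic hw.
pose C j v := pr_poly j v = v /\ exists2 w, pr_poly (j - 1) w = w & B' (v - Y *: w).
have CE j v : pr_poly j v = v -> adjoin Y B' v <-> C j v.
  move=> hv; split=> [[w hw]|[_ [w _ hw]]]; last by exists w.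
  split=> //; exists (pr_poly (j - 1) w).
    by apply/coefrP => k; rewrite !coefr_pr_poly (gq_prK gq).
  by have := pr_polyB j hw; rewrite pr_poly_sub hv pr_poly_generic.
have /choice[h' rk'] j : exists m, has_rank phi' (fun v => pr_poly j v = v) (adjoin Y B') m.
  have [e [Ge _ ge]] := rk j.
  apply: (has_rank_torsion_gen (submod_dsubmod _ sBY) (e := e)).
  by apply: torsion_gen_sub ge => // v _; apply: sub_adjoin.
exists h'; last first.
  move=> j; apply/eqP; rewrite /delta eq_sym subr_eq -PoszD; apply/eqP; congr Posz.
  rewrite addnC; apply: (has_rank_add (B := B') (C := C j)) (rk j) _ _.
  - exact: submod_dsubmod.
  - split.
    + split; first exact: dsubmod0 (sG j).
      by exists 0; rewrite ?scaler0 ?subr0; [apply: dsubmod0 (sG _)|apply: submod0].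
    + move=> u v [Gu [u' Gu' hu]] [Gv [v' Gv' hv]]; split; first exact: (dsubmodD (sG j)).
      exists (u' + v'); first exact: (dsubmodD (sG _)).
      by rewrite scalerDr opprD addrACA; apply: (submodD sB').
    + move=> d v [Gv [v' Gv' hv]]; split; first exact: (dsubmodZ (sG j)).
      exists (phi' d *: v'); first exact: (dsubmodZ (sG _)).
      by rewrite scalerA mulrC -scalerA -scalerBr; apply: (submodZ sB').
  - exact: sG.
  - by move=> v [].
  - by move=> v Gv Bv; apply/CE => //; apply: sub_adjoin.
  - by apply: has_rank_mul (rk (j - 1)) => //; apply: YG.
  - exact: has_rank_ext (CE j) (rk' j).
split=> //.
- exact: pr_polyD.
- move=> j d v; apply/coefrP => k; rewrite coefr_pr_poly !coefrZ pr_sum.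
  by apply: eq_bigr => i _; rewrite coefr_pr_poly coef_map (gq_prZ gq).
- by move=> j v; apply/coefrP => k; rewrite !coefr_pr_poly (gq_prK gq).
- move=> j _ v /mapP[x xxs ->]; apply/coefrP => k.
  by rewrite coefr_pr_poly !coefrC coefr_pr_poly (gq_prX gq).
- move=> j v [w hw]; exists (pr_poly (j - 1) w).
  by have := pr_polyB j hw; rewrite pr_poly_sub pr_poly_generic.
Qed.

End GenericStep.

(** Induction on the length of the sequence: one element is traded for one
    indeterminate and one difference. *)
Lemma regular_delta_ge0 (D : idomainType) (R : comNzRingType) (phi : {rmorphism D -> R})
    (s : nat) (xs fs : seq R) (B : 'rV[R]_s -> Prop) pr (h : int -> nat) :
    graded_quot phi xs B pr h -> (forall f, f \in fs -> in_ideal xs f) ->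
    regular B fs ->
  forall j, 0 <= iter (size fs) delta (fun i => (h i)%:Z) j.
Proof.
have [r] := ubnP (size fs); elim: r => // r IH in D R phi xs fs B pr h *.
case: fs => [|f fs] lt gq hxs reg j; first by [].
have Y := nonzerodiv_generic_head (gq_sub gq) hxs reg.
have [h' gq' h'E] := graded_quot_generic gq Y.
have reg' := regular_generic (gq_sub gq) hxs reg.
have := IH _ _ _ _ (map polyC (belast f fs)) _ _ _ _ gq' _ reg' j.
rewrite size_map size_belast /= -iterS iterSr (_ : delta _ = fun i => (h' i)%:Z).
  apply=> // _ /mapP[g gfs ->].
  have /hxs[c ->] : g \in f :: fs by apply: mem_belast gfs.
  exists (fun l => (c l)%:P); rewrite size_map rmorph_sum; apply: eq_bigr => l _.
  by rewrite rmorphM (nth_map 0).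
by apply/funext => i; rewrite h'E.
Qed.

(** * Graded modules over a polynomial ring *)

Section Homogeneous.
Variables (K : fieldType) (n : nat).
Local Notation S := {mpoly K[n]}.

Definition homog_comp (j : int) (f : S) : S := if j is Posz d then pihomog mdeg d f else 0.

Lemma homog_compD j : {morph homog_comp j : f g / f + g}.
Proof. by case: j => [d|d] f g /=; rewrite ?addr0 // raddfD. Qed.

Lemma homog_comp0 j : homog_comp j 0 = 0.
Proof. by case: j => [d|d] //=; rewrite raddf0. Qed.

Lemma homog_comp_sum j I (r : seq I) (P : pred I) (f : I -> S) :
  homog_comp j (\sum_(i <- r | P i) f i) = \sum_(i <- r | P i) homog_comp j (f i).
Proof. exact: (big_morph _ (@homog_compD j) (homog_comp0 j)). Qed.

Lemma homog_compZ j c f : homog_comp j (c *: f) = c *: homog_comp j f.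
Proof. by case: j => [d|d] /=; rewrite ?scaler0 // linearZ. Qed.

Lemma homog_compX j m : homog_comp j 'X_[m] = if j == (mdeg m)%:Z then 'X_[m] else 0.
Proof. by case: j => [d|d] //=; rewrite pihomogX eqz_nat eq_sym. Qed.

Lemma mcoeff_sum m I (r : seq I) (P : pred I) (f : I -> S) :
  (\sum_(i <- r | P i) f i)@_m = \sum_(i <- r | P i) (f i)@_m.
Proof. exact: (big_morph _ (@mcoeffD n K m) (mcoeff0 K m)). Qed.

Lemma mcoeff_homog_comp j f m : (homog_comp j f)@_m = f@_m *+ (j == (mdeg m)%:Z).
Proof.
rewrite [f in LHS]mpolyE homog_comp_sum [in RHS](mpolyE f) !mcoeff_sum -sumrMnl.
apply: eq_bigr => k _; rewrite homog_compZ homog_compX !mcoeffZ mcoeffX.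
have [->|km] := eqVneq k m; last first.
  by case: ifP; rewrite ?mcoeff0 ?mcoeffX ?(negPf km) !mulr0 mul0rn.
by case: eqP => _; rewrite ?mcoeff0 ?mcoeffX ?eqxx ?mulr0 ?mulr1n.
Qed.

Lemma homog_comp_deg j f : poly_deg j (homog_comp j f).
Proof. by case: j => [d|d] //=; apply: pihomogP. Qed.

Lemma homog_comp_id j f : poly_deg j f -> homog_comp j f = f.
Proof. by case: j => [d|d] /= h; rewrite ?pihomog_dE // h. Qed.

Lemma homog_comp_mulX j i f : homog_comp j ('X_i * f) = 'X_i * homog_comp (j - 1) f.
Proof.
rewrite [f]mpolyE mulr_sumr !homog_comp_sum mulr_sumr; apply: eq_bigr => m _.
rewrite -scalerAr !homog_compZ -scalerAr -mpolyXD !homog_compX mdegD mdeg1; congr (_ *: _).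
rewrite subr_eq addrC -PoszD; case: eqP => _; by rewrite ?mulr0 ?mpolyXD.
Qed.

Lemma sum_homog_comp (t : seq int) (e : int) f : uniq t ->
    (forall d, (d < msize f)%N -> e + d%:Z \in t) ->
  \sum_(j <- t) homog_comp (j - e) f = f.
Proof.
move=> ut ht; apply/mpolyP => m; rewrite mcoeff_sum.
under eq_bigr do rewrite mcoeff_homog_comp subr_eq addrC.
have [->|fm] := eqVneq f@_m 0; first by rewrite big1 // => j _; rewrite mul0rn.
have mt : e + (mdeg m)%:Z \in t.
  by apply/ht/msize_mdeg_lt; rewrite mcoeff_msupp.
rewrite (bigD1_seq _ mt ut) /= eqxx big1 => [|j /negPf-> //].
by rewrite addr0 mulr1n.
Qed.

Lemma sum_vars_of_support (A : {set 'I_n}) (f : S) :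
    (forall m, m \in msupp f -> exists2 i, i \in A & (0 < m i)%N) ->
  exists g : 'I_n -> S, f = \sum_(i in A) g i * 'X_i.
Proof.
move=> hA.
have /choice[g hg] : forall m, exists g : 'I_n -> S,
    m \in msupp f -> f@_m *: 'X_[m] = \sum_(i in A) g i * 'X_i.
  move=> m; case: (boolP (m \in msupp f)) => mf; last by exists (fun=> 0).
  have [i iA mi] := hA m mf.
  exists (fun j => if j == i then f@_m *: 'X_[m - U_(i)] else 0) => _.
  rewrite (bigD1 i iA) /= eqxx big1 ?addr0 => [|j /andP[_ /negPf->]]; last by rewrite mul0r.
  rewrite -scalerAl -mpolyXD submK //; apply/mnm_lepP => j; rewrite mnm1E.
  by case: eqP => // <-.
exists (fun i => \sum_(m <- msupp f) g m i).
rewrite {1}[f]mpolyE (eq_big_seq (fun m => \sum_(i in A) g m i * 'X_i)) //.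
by rewrite exchange_big /=; apply: eq_bigr => i _; rewrite mulr_suml.
Qed.

Definition vars : seq S := [seq 'X_i | i <- enum 'I_n].

Lemma size_vars : size vars = n.
Proof. by rewrite size_map size_enum_ord. Qed.

Lemma nth_vars (i : 'I_n) : vars`_i = 'X_i.
Proof. by rewrite (nth_map i) ?size_enum_ord // nth_ord_enum. Qed.

Lemma in_ideal_vars (f : S) : f@_0 = 0 -> in_ideal vars f.
Proof.
move=> f0; have [m|g fE] := @sum_vars_of_support [set: _] f.
  rewrite mcoeff_msupp => fm; have [//|m0] := eqVneq m 0%MM.
    by move=> mE; rewrite mE f0 eqxx in fm.
  have [/existsP[i mi]|/existsPn no] := boolP [exists i, (0 < m i)%N].
    by exists i; rewrite ?inE.
  case/eqP: m0; apply/mnmP => i; rewrite mnm0E; apply/eqP.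
  by rewrite -leqn0 leqNgt no.
exists (fun l => if insub l is Some i then g i else 0).
rewrite fE big_set /= size_vars; apply: eq_bigr => i _.
by rewrite valK nth_vars.
Qed.

End Homogeneous.

Section FreeBases.
Variables (K : fieldType) (n : nat) (M : lmodType {mpoly K[n]}).
Local Notation phi := (@mpolyC n K).

Lemma submod_zero : submod (fun v : M => v = 0).
Proof. by split=> // [u v -> ->|a v ->]; rewrite ?addr0 ?scaler0. Qed.

Lemma K_basis_gen (U : M -> Prop) d (b : 'I_d -> M) :
  K_basis U b -> torsion_gen phi U (fun v => v = 0) b.
Proof.
case=> Ub ib gb u Uu; have [c uE] := gb u Uu.
exists 1, c; rewrite oner_neq0; split=> //.
by rewrite rmorph1 scale1r uE subrr.
Qed.

Lemma K_dimE (U : M -> Prop) d (b : 'I_d -> M) : K_basis U b -> K_dim U = d.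
Proof.
move=> bb; rewrite /K_dim; case: classical_sets.xgetP => [d' -> [b' bb']|/(_ d) []]; last by exists b.
have sB := submod_dsubmod phi submod_zero.
have [Ub ib _] := bb; have [Ub' ib' _] := bb'.
have := steinitz sB (K_basis_gen bb) Ub' ib'.
have := steinitz sB (K_basis_gen bb') Ub ib.
by rewrite !card_ord => h1 h2; apply/eqP; rewrite eqn_leq h1 h2.
Qed.

Lemma K_basis_exists (U : M -> Prop) (I : finType) (e : I -> M) :
    (forall u, U u -> exists c : I -> K, u = \sum_i (c i)%:MP *: e i) ->
  exists b : 'I_(K_dim U) -> M, K_basis U b.
Proof.
move=> ge.
have [|m [b [Ub ib gb]]] := @has_rank_torsion_gen _ _ phi _ U _ I e (submod_dsubmod phi submod_zero).
  move=> u /ge[c uE]; exists 1, c; rewrite oner_neq0; split=> //.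
  by rewrite rmorph1 scale1r uE subrr.
have bb : K_basis U b.
  split=> // u /gb[d [c [d0 /eqP]]]; rewrite subr_eq0 => /eqP uE.
  exists (fun i => d^-1 * c i).
  rewrite -[u]scale1r -(rmorph1 phi) -(mulVf d0) rmorphM -scalerA uE scaler_sumr.
  by apply: eq_bigr => i _; rewrite scalerA -rmorphM.
by rewrite (K_dimE bb); exists b.
Qed.

Lemma K_basis_fin (U : M -> Prop) (I : finType) (e : I -> M) :
    (forall i, U (e i)) ->
    (forall c : I -> K, \sum_i (c i)%:MP *: e i = 0 -> forall i, c i = 0) ->
    (forall u, U u -> exists c : I -> K, u = \sum_i (c i)%:MP *: e i) ->
  K_basis U (fun i : 'I_#|I| => e (enum_val i)).
Proof.
move=> Ue ie ge.
have reE (c : 'I_#|I| -> K) : \sum_i (c i)%:MP *: e (enum_val i) =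
    \sum_i (c (enum_rank i))%:MP *: e i.
  rewrite [RHS](reindex (@enum_val I I)) /=; last first.
    by exists enum_rank => i _; rewrite ?enum_valK ?enum_rankK.
  by apply: eq_bigr => i _; rewrite enum_valK.
split=> // [c|u /ge[c ->]].
  by rewrite reE => /ie ce i; rewrite -(enum_valK i) ce.
exists (fun i => c (enum_val i)); rewrite reE.
by apply: eq_bigr => i _; rewrite enum_rankK.
Qed.

End FreeBases.

Section GradedModule.
Variables (K : fieldType) (n : nat) (M : lmodType {mpoly K[n]}).
Variable Mdeg : int -> M -> Prop.
Hypotheses (M_fg : fin_gen M) (M_gr : is_grading Mdeg).
Local Notation S := {mpoly K[n]}.
Local Notation phi := (@mpolyC n K).

(** The homogeneous components of generators generate. *)
Lemma homogeneous_generators : exists (m : nat) (e : 'I_m -> int) (g : 'I_m -> M),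
  (forall i, Mdeg (e i) (g i)) /\
  forall v, exists a : 'I_m -> S, v = \sum_i a i *: g i.
Proof.
have [s gs] := M_fg.
have /choice[t /choice[c tc]] : forall i : 'I_(size s), exists (t : seq int) (c : int -> M),
    (forall j, Mdeg j (c j)) /\ s`_i = \sum_(j <- t) c j.
  by move=> i; apply: grading_span M_gr _.
pose I := {i : 'I_(size s) & 'I_(size (t i))}.
pose e (u : I) : int := (t (tag u))`_(tagged u).
pose g (u : I) : M := c (tag u) (e u).
exists #|{: I}|, (fun i => e (enum_val i)), (fun i => g (enum_val i)); split.
  by move=> i; apply: (tc _).1.
move=> v; have [a ->] := gs v.
exists (fun i => a (tag (enum_val i))).
transitivity (\sum_(u : I) a (tag u) *: g u).
  rewrite (eq_bigr (fun i => \sum_(j < size (t i)) a i *: c i (t i)`_j)).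
    by rewrite sig_big_dep.
  by move=> i _; rewrite (tc i).2 (big_nth 0) big_mkord scaler_sumr.
rewrite (reindex (@enum_val {: I} {: I})) //=.
by exists enum_rank => i _; rewrite ?enum_valK ?enum_rankK.
Qed.

(** A presentation [pres : S^m -> M] by homogeneous generators [g i] of degrees
    [e i], with the grading of [S^m] that makes it homogeneous. *)
Section Presentation.
Variables (m : nat) (e : 'I_m -> int) (g : 'I_m -> M).
Hypothesis Mg : forall i, Mdeg (e i) (g i).
Hypothesis gen_g : forall v, exists a : 'I_m -> S, v = \sum_i a i *: g i.

Definition pres (v : 'rV[S]_m) : M := \sum_i v 0 i *: g i.

Definition pres_comp (j : int) (v : 'rV[S]_m) : 'rV[S]_m :=
  \row_i homog_comp (j - e i) (v 0 i).

Lemma pres_is_linear : linear pres.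
Proof.
move=> a u v; rewrite /pres scaler_sumr -big_split; apply: eq_bigr => i _.
by rewrite !mxE scalerDl scalerA.
Qed.

HB.instance Definition _ :=
  GRing.isLinear.Build S 'rV[S]_m M *:%R pres pres_is_linear.

Lemma pres_surj v : exists u, pres u = v.
Proof.
have [a ->] := gen_g v; exists (\row_i a i).
by apply: eq_bigr => i _; rewrite mxE.
Qed.

Lemma Mdeg_sum j I (r : seq I) (P : pred I) (v : I -> M) :
  (forall i, P i -> Mdeg j (v i)) -> Mdeg j (\sum_(i <- r | P i) v i).
Proof. exact: (big_ind _ (grading_0 M_gr j) (@grading_add _ _ _ _ M_gr j)). Qed.

Lemma Mdeg_scale k j (f : S) v : poly_deg k f -> Mdeg j v -> Mdeg (k + j) (f *: v).
Proof.
case: k => [d|d] /= hf hv; first exact: grading_scale.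
rewrite hf scale0r; exact: grading_0.
Qed.

Lemma MdegN j v : Mdeg j v -> Mdeg j (- v).
Proof.
move=> hv; rewrite -scaleN1r -[j]add0r; apply: Mdeg_scale => //=.
by rewrite rpredN dhomog1.
Qed.

Lemma pres_comp_deg j v : Mdeg j (pres (pres_comp j v)).
Proof.
apply: Mdeg_sum => i _; rewrite mxE -[j in Mdeg j](subrK (e i)).
by apply: Mdeg_scale => //; apply: homog_comp_deg.
Qed.

(** Applied to [pres v = 0], this shows that the kernel of the presentation is
    stable under the projections. *)
Lemma pres_homog j v : Mdeg j (pres v) -> pres (pres_comp j v) = pres v.
Proof.
move=> hv.
pose t := undup (j :: flatten [seq [seq e i + d%:Z | d <- iota 0 (msize (v 0%R i))]
  | i <- enum 'I_m]).
have ut : uniq t by apply: undup_uniq.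
have jt : j \in t by rewrite mem_undup mem_head.
have vE : v = \sum_(j <- t) pres_comp j v.
  apply/rowP => i; rewrite summxE -[LHS](@sum_homog_comp _ _ t (e i) _ ut).
    by apply: eq_bigr => k _; rewrite mxE.
  move=> d hd; rewrite mem_undup inE; apply/orP; right; apply/flattenP.
  exists [seq e i + d%:Z | d <- iota 0 (msize (v 0 i))].
    by apply/mapP; exists i; rewrite ?mem_enum.
  by apply/mapP; exists d; rewrite ?mem_iota.
pose c k := pres (pres_comp k v) - (if k == j then pres v else 0).
apply/eqP; rewrite -subr_eq0; apply/eqP.
have := @grading_direct _ _ _ _ M_gr t c ut _ _ j jt; rewrite /c eqxx; apply.
  move=> k; apply: grading_add => //; first exact: pres_comp_deg.
  by case: eqP => [->|_]; apply: MdegN => //; apply: grading_0.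
rewrite sumrB -[X in X - _]raddf_sum -vE (bigD1_seq _ jt ut) /= eqxx big1.
  by rewrite addr0 subrr.
by move=> k /negPf->.
Qed.

(** The component of degree [j] is spanned by the finitely many products of a
    generator by a monomial of complementary degree. *)
Lemma pres_K_basis j : exists b : 'I_(hilbert Mdeg j) -> M, K_basis (Mdeg j) b.
Proof.
pose b := (\max_i (`|j - e i|.+1))%N.
pose w (u : 'I_m * 'X_{1..n < b}) : M := 'X_[u.2] *: g u.1.
apply: (@K_basis_exists _ _ _ _ _ w) => u.
have [v <-] := pres_surj u => /pres_homog <-.
exists (fun u : 'I_m * 'X_{1..n < b} => (pres_comp j v 0 u.1)@_u.2).
rewrite /pres -(pair_bigA _ (fun i (u : 'X_{1..n < b}) => ((pres_comp j v 0 i)@_u)%:MP *: w (i, u))) /=.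
apply: eq_bigr => i _; rewrite {1}[pres_comp j v 0 i](@mpolywE _ _ b); last first.
  rewrite mxE msizeE; apply/bigmax_leqP_seq => k; rewrite mcoeff_msupp mcoeff_homog_comp => kf _.
  apply: leq_trans (leq_bigmax i); case: (j - e i =P (mdeg k)%:Z) kf => [->|]; first by rewrite absz_nat.
  by rewrite mulr0n eqxx.
rewrite scaler_suml; apply: eq_bigr => k _.
by rewrite -mul_mpolyC -scalerA.
Qed.

Lemma pres_graded_quot :
  graded_quot phi (vars K n) (fun v => pres v = 0) pres_comp (hilbert Mdeg).
Proof.
split.
- split=> [|u v hu hv|a v hv]; first by rewrite raddf0.
    by rewrite raddfD /= hu hv addr0.
  by rewrite linearZ /= hv scaler0.
- by move=> j u v; apply/rowP => i; rewrite !mxE homog_compD.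
- by move=> j d v; apply/rowP => i; rewrite !mxE !mul_mpolyC homog_compZ.
- move=> j v; apply/rowP => i; rewrite !mxE homog_comp_id //; exact: homog_comp_deg.
- move=> j _ v /mapP[i _ ->]; apply/rowP => k; rewrite !mxE homog_comp_mulX.
  by rewrite addrAC.
- by move=> j v hv; rewrite pres_homog // hv; apply: grading_0.
move=> j; have [b [Ub ib gb]] := pres_K_basis j.
have /choice[w hw] : forall i, exists u, pres_comp j u = u /\ pres u = b i.
  move=> i; have [u hu] := pres_surj (b i); exists (pres_comp j u); split.
    apply/rowP => k; rewrite !mxE homog_comp_id //; exact: homog_comp_deg.
  by rewrite pres_homog hu.
have lE c : pres (lincomb phi c w) = \sum_i (c i)%:MP *: b i.
  rewrite raddf_sum; apply: eq_bigr => i _; by rewrite /= linearZ /= (hw i).2.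
exists w; split.
- by move=> i; case: (hw i).
- by move=> c; rewrite lE; apply: ib.
move=> u hu; have /gb[c uE] : Mdeg j (pres u) by rewrite -hu; apply: pres_comp_deg.
exists 1, c; rewrite oner_neq0; split=> //.
by rewrite rmorph1 scale1r raddfB /= lE uE subrr.
Qed.

End Presentation.

Lemma hilbert_basis j : exists b : 'I_(hilbert Mdeg j) -> M, K_basis (Mdeg j) b.
Proof.
by have [m [e [g [Mg gen_g]]]] := homogeneous_generators; apply: (pres_K_basis Mg gen_g).
Qed.

(** The part of regularity that is inherited by initial segments and by direct
    sums. *)
Definition weakly_regular (fs : seq S) := forall i, (i < size fs)%N -> forall v : M,
  seq_mul (take i fs) (fs`_i *: v) -> seq_mul (take i fs) v.

Lemma seq_mulP (fs : seq S) (v : M) :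
  seq_mul fs v <-> exists w : nat -> M, v = \sum_(i < size fs) fs`_i *: w i.
Proof.
split=> [[w ->]|[w ->]]; last by exists (fun i => w i).
exists (fun i => if insub i is Some k then w k else 0).
by apply: eq_bigr => i _; rewrite valK.
Qed.

Lemma seq_mul_rcons fs f (v : M) :
  seq_mul (rcons fs f) v <-> exists w, seq_mul fs (v - f *: w).
Proof.
rewrite seq_mulP size_rcons; split=> [[w ->]|[u /seq_mulP[w vE]]].
  exists (w (size fs)); apply/seq_mulP; exists w.
  rewrite big_ord_recr /= nth_rcons ltnn eqxx addrK.
  by apply: eq_bigr => i _; rewrite nth_rcons ltn_ord.
exists (fun i => if i == size fs then u else w i).
rewrite big_ord_recr /= nth_rcons ltnn !eqxx -[v](subrK (f *: u)) vE.
congr (_ + _); apply: eq_bigr => i _.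
by rewrite nth_rcons ltn_ord ltn_eqF.
Qed.

Lemma weakly_regular_delta fs :
    (forall f, f \in fs -> f@_0 = 0) -> weakly_regular fs ->
  forall j, 0 <= iter (size fs) delta (fun i => (hilbert Mdeg i)%:Z) j.
Proof.
move=> fs0 reg; have [m [e [g [Mg gen_g]]]] := homogeneous_generators.
apply: (regular_delta_ge0 (pres_graded_quot Mg gen_g)).
  by move=> f /fs0; apply: in_ideal_vars.
(* [pre] is the part of the sequence that has been divided out already. *)
suff key pre post : fs = pre ++ post -> regular (fun v => seq_mul pre (pres g v)) post.
  have -> : (fun v => pres g v = 0) = (fun v => seq_mul [::] (pres g v)).
    apply/funext => v; apply/propext; rewrite seq_mulP /=.
    by split=> [->|[w ->]]; [exists (fun=> 0)|]; rewrite big_ord0.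
  exact: key.
elim: post pre => //= f post IH pre fsE; split.
  move=> v; rewrite linearZ /= => hv.
  have := reg (size pre); rewrite fsE size_cat /= nth_cat ltnn subnn /= take_size_cat //.
  by apply=> //; lia.
have -> : adjoin f (fun v => seq_mul pre (pres g v)) =
          (fun v => seq_mul (rcons pre f) (pres g v)).
  apply/funext => v; apply/propext; rewrite seq_mul_rcons; split=> [[w hw]|[u]].
    by exists (pres g w); rewrite raddfB /= linearZ in hw.
  have [w <-] := pres_surj gen_g u; exists w.
  by rewrite raddfB /= linearZ.
by apply: IH; rewrite cat_rcons.
Qed.

Lemma regular_seq_take m fs : @regular_seq K n M fs -> weakly_regular (take m fs).
Proof.
move=> [reg _] i; rewrite size_take => im v.
have [im' ifs] : (i < m)%N /\ (i < size fs)%N by move: im; case: (ltnP m (size fs)) => h1 h2; lia.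
rewrite take_takel ?nth_take //; [exact: reg|exact: ltnW].
Qed.

End GradedModule.

(** * Counting monomials by their support *)

Lemma eq_iter_delta d f g : f =1 g -> iter d delta f =1 iter d delta g.
Proof. by move=> fg j; rewrite (_ : f = g) //; apply/funext. Qed.

Lemma iter_delta_sum d I (r : seq I) (P : pred I) (f : I -> int -> int) j :
  iter d delta (fun j => \sum_(i <- r | P i) f i j) j =
  \sum_(i <- r | P i) iter d delta (f i) j.
Proof.
elim: d j => //= d IH j; rewrite /delta !IH.
by rewrite -sumrB.
Qed.

Lemma iter_deltaZ d c f j :
  iter d delta (fun j => c * f j) j = c * iter d delta f j.
Proof. by elim: d j => //= d IH j; rewrite /delta !IH mulrBr. Qed.

Lemma iter_delta_shift d a f j :
  iter d delta (fun j => f (j - a)) j = iter d delta f (j - a).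
Proof. by elim: d j => //= d IH j; rewrite /delta !IH addrAC. Qed.

(** Injectivity of the difference operator on functions with prescribed values
    in negative degrees: it is multiplication by the invertible power series
    [1 - t]. *)
Lemma iter_delta_inj d f g :
    (forall k, f (Negz k) = g (Negz k)) ->
    iter d delta f =1 iter d delta g ->
  f =1 g.
Proof.
have ng k : Negz k - 1 = Negz k.+1 by rewrite !NegzE; lia.
elim: d f g => // d IH f g fg; rewrite !iterSr => h.
have dfg : delta f =1 delta g by apply: (IH _ _ _ h) => k; rewrite /delta ng !fg.
case=> [k|k]; last exact: fg.
elim: k => [|k IHk]; first by have := dfg 0; rewrite /delta -[0 - 1]/(Negz 0) fg; apply: addIr.
have := dfg k.+1; rewrite /delta (_ : k.+1%:Z - 1 = k); last by lia.
by rewrite IHk; apply: addIr.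
Qed.

(** The number of monomials of degree [k] whose support is a given set of [e]
    variables, with the recursion that comes from dividing by one of them. *)
Fixpoint supp_count (e k : nat) := match k with
  | 0 => e == 0%N : nat
  | k'.+1 => if e is e'.+1 then (supp_count e k' + supp_count e' k')%N else 0%N
  end.

Definition supp_fun (e : nat) (j : int) : int :=
  if j is Posz k then (supp_count e k)%:Z else 0.

(** The generating series of [supp_fun e] is [(t / (1 - t))^e]. *)
Lemma delta_supp_fun e j : delta (supp_fun e.+1) j = supp_fun e (j - 1).
Proof.
case: j => [[|k]|k]; rewrite /delta //.
  rewrite (_ : k.+1%:Z - 1 = k); last by lia.
  by rewrite /= PoszD addrAC subrr add0r.
Qed.

Lemma iter_delta_supp0 m j : iter m delta (supp_fun 0) j =
  if j is Posz k then beta_coef m k 0 else 0.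
Proof.
elim: m j => [|m IH] j /=.
  by case: j => // -[|k] //=; rewrite /beta_coef subn0 bin0n oppr0 if_same.
rewrite /delta !IH; case: j => [[|k]|k] //.
- by rewrite /beta_coef /= !bin0 subr0.
- rewrite (_ : k.+1%:Z - 1 = k); last by lia.
  rewrite /beta_coef !subn0 /= binS PoszD; case: (odd k) => /=; lia.
Qed.

(** The generating series is [t^e (1 - t)^(d - e)] in the first case and
    [t^d (t / (1 - t))^(e - d)] in the second one. *)
Lemma iter_delta_supp d e j : iter d delta (supp_fun e) j =
  if (e <= d)%N then iter (d - e) delta (supp_fun 0) (j - e%:Z)
  else supp_fun (e - d) (j - d%:Z).
Proof.
elim: d e j => [|d IH] [|e] j; rewrite ?subr0 //.
rewrite iterSr (eq_iter_delta d (delta_supp_fun e)) (iter_delta_shift d 1).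
rewrite IH ltnS subSS; case: ifP => _; congr (_ _); lia.
Qed.

Lemma iter_delta_supp_low d e k : (k <= d)%N ->
  iter d delta (supp_fun e) k%:Z = if (e <= k)%N then beta_coef d k e else 0.
Proof.
move=> kd; rewrite iter_delta_supp; case: (leqP e k) => ek.
  rewrite (leq_trans ek kd) iter_delta_supp0 subzn //.
  by rewrite /beta_coef !subn0.
case: ifP => [ed|/negbT]; rewrite -?ltnNge.
  by rewrite iter_delta_supp0; case E: (k%:Z - e%:Z) => [i|i] //; lia.
case E: (k%:Z - d%:Z) => [[|i]|i] // de; last by lia.
by rewrite /= subn_eq0 leqNgt de.
Qed.

Lemma iter_delta_supp_high d e k : (e <= d)%N -> (d < k)%N ->
  iter d delta (supp_fun e) k%:Z = 0.
Proof.
move=> ed dk; rewrite iter_delta_supp ed iter_delta_supp0 subzn ?(leq_trans ed (ltnW dk)) //.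
by rewrite /beta_coef !subn0 bin_small ?oppr0 ?if_same //; lia.
Qed.

Section SupportCount.
Variable n : nat.
Implicit Types (A E : {set 'I_n}) (F : {set {set 'I_n}}).

Definition msupport (m : 'X_{1..n}) : {set 'I_n} := [set i | 0 < m i]%N.

Lemma msupport0 : msupport 0%MM = set0.
Proof. by apply/setP => i; rewrite !inE mnm0E. Qed.

Lemma msupport_eq0 m : (msupport m == set0) = (m == 0%MM).
Proof.
apply/eqP/eqP => [/setP h|->]; last exact: msupport0.
apply/mnmP => i; rewrite mnm0E; apply/eqP; have := h i.
by rewrite !inE lt0n => /negbFE.
Qed.

Lemma msupportDU m i : msupport (m + U_(i))%MM = i |: msupport m.
Proof.
by apply/setP => j; rewrite !inE mnmDE mnm1E addn_gt0 lt0b orbC eq_sym.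
Qed.

Definition monomials F k : {set 'X_{1..n < k.+1}} :=
  [set m : 'X_{1..n < k.+1} | (mdeg m == k) && (msupport m \in F)].

(** Division by a variable [i] of [A] maps the monomials with support [A]
    bijectively to those with support [A] or [A :\ i]. *)
Lemma card_monomials1 A k : #|monomials [set A] k| = supp_count #|A| k.
Proof.
elim: k A => [|k IH] A.
  pose m0 : 'X_{1..n < 1} := @bm0 n 0.
  have E : monomials [set A] 0 = if A == set0 then [set m0] else set0.
    apply/setP => m; rewrite !inE mdeg_eq0.
    have [->|A0] := eqVneq A set0; first by rewrite inE msupport_eq0 andbb bmeqP.
    rewrite inE; apply/negP => /andP[/eqP -> /eqP h].
    by case/eqP: A0; rewrite -h msupport0.
  by rewrite E /= cards_eq0; case: eqP => _; rewrite ?cards1 ?cards0.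
have [->|/set0Pn[i iA]] := eqVneq A set0.
  rewrite cards0 /=; apply/eqP; rewrite cards_eq0 -subset0; apply/subsetP => m.
  rewrite !inE msupport_eq0 => /andP[/eqP h /eqP m0].
  by move: h; rewrite m0 mdeg0.
have bd (m : 'X_{1..n < k.+1}) : (mdeg (m + U_(i))%MM < k.+2)%N.
  by rewrite mdegD mdeg1 addn1 ltnS bmdeg.
pose f (m : 'X_{1..n < k.+1}) : 'X_{1..n < k.+2} := BMultinom (bd m).
have finj : injective f by move=> m m' /(congr1 val) /= /addIm /val_inj.
have cA : #|A| = #|A :\ i|.+1 by rewrite (cardsD1 i A) iA.
rewrite [in RHS]cA /= -cA -!IH -(card_imset (monomials [set A] k) finj).
rewrite -(card_imset (monomials [set A :\ i] k) finj) -cardsUI.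
have -> : f @: monomials [set A] k :&: f @: monomials [set A :\ i] k = set0.
  apply/setP => m; rewrite !inE; apply/negP => /andP[/imsetP[u + ->] /imsetP[v + /finj uv]].
  rewrite -uv !inE => /andP[_ /eqP ->] /andP[_ /eqP/setP/(_ i)].
  by rewrite !inE iA eqxx.
rewrite cards0 addn0; apply: eq_card => m; apply/idP/idP.
  rewrite !inE => /andP[/eqP dm /eqP sm].
  have mi : (0 < m i)%N by move: iA; rewrite -sm inE.
  have mE : (m - U_(i) + U_(i))%MM = m.
    by apply: submK; apply/mnm_lepP => j; rewrite mnm1E; case: eqP => // <-.
  have dm' : mdeg (m - U_(i))%MM = k.
    by move: dm; rewrite -{1}mE mdegD mdeg1 addn1 => -[].
  have bm' : (mdeg (m - U_(i))%MM < k.+1)%N by rewrite dm'.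
  have fm : f (BMultinom bm') = m by apply: val_inj.
  have := sm; rewrite -{1}mE msupportDU.
  set A' := msupport _ => A'E.
  have [iA'|iA'] := boolP (i \in A').
    apply/orP; left; apply/imsetP; exists (BMultinom bm') => //.
    by rewrite !inE /= dm' eqxx -A'E /= (setUidPr _) ?sub1set.
  apply/orP; right; apply/imsetP; exists (BMultinom bm') => //.
  by rewrite !inE /= dm' eqxx -A'E /= setU1K.
rewrite inE => /orP[]/imsetP[u + ->]; rewrite !inE => /andP[/eqP du /eqP su] /=.
  by rewrite mdegD mdeg1 du addn1 eqxx msupportDU su (setUidPr _) ?sub1set ?eqxx.
by rewrite mdegD mdeg1 du addn1 eqxx msupportDU su setD1K ?eqxx.
Qed.

Lemma card_monomials F k : #|monomials F k| = (\sum_(A in F) supp_count #|A| k)%N.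
Proof.
rewrite -sum1_card (partition_big (fun m : 'X_{1..n < k.+1} => msupport m) (mem F)) /=.
  apply: eq_bigr => A AF; rewrite -card_monomials1 -sum1_card; apply: eq_bigl => m.
  rewrite !inE -andbA; congr (_ && _).
  by case: (msupport m =P A) => [->|_]; rewrite ?AF ?andbF.
by move=> m; rewrite inE => /andP[].
Qed.

Definition mono_count F (j : int) : nat := if j is Posz k then #|monomials F k| else 0%N.

Lemma mono_countE F j : (mono_count F j)%:Z = \sum_(A in F) supp_fun #|A| j.
Proof.
case: j => [k|k] /=; last by rewrite big1.
by rewrite card_monomials (big_morph Posz PoszD (erefl _)).
Qed.

Lemma delta_mono_count d F j : iter d delta (fun j => (mono_count F j)%:Z) j =
  \sum_(A in F) iter d delta (supp_fun #|A|) j.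
Proof.
by rewrite (eq_iter_delta d (mono_countE F)) iter_delta_sum.
Qed.

Lemma delta_mono_count_beta d F k : (k <= d)%N ->
  iter d delta (fun j => (mono_count F j)%:Z) k%:Z = beta d F k.
Proof.
move=> kd; rewrite delta_mono_count /beta big_mkcondr; apply: eq_bigr => A _.
by rewrite iter_delta_supp_low.
Qed.

End SupportCount.

Lemma supp_count_diag e : supp_count e e != 0%N.
Proof. by elim: e => //= e IH; rewrite addn_eq0 negb_and IH orbT. Qed.

Lemma iter_delta0 d j : iter d delta (fun=> 0) j = 0.
Proof. by elim: d j => //= d IH j; rewrite /delta !IH. Qed.

Section Decomposition.
Variable n : nat.
Implicit Types (A E : {set 'I_n}) (F : {set {set 'I_n}}).

Lemma card_ord_le A : (#|A| <= n)%N.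
Proof. by have := max_card (mem A); rewrite card_ord. Qed.

Lemma mono_count_eq0 F : (forall j, mono_count F j = 0%N) -> F = set0.
Proof.
move=> h; apply/eqP; rewrite -subset0; apply/subsetP => A AF.
have := h #|A|%:Z; rewrite /= card_monomials (bigD1 A) //= => /eqP.
by rewrite addn_eq0 (negPf (supp_count_diag _)).
Qed.

Lemma delta_neg (d : nat) (f : int -> int) : (forall k, f (Negz k) = 0) ->
  forall k, iter d delta f (Negz k) = 0.
Proof.
move=> f0; elim: d => // d IH k.
rewrite iterS /delta (_ : Negz k - 1 = Negz k.+1); last by rewrite !NegzE; lia.
by rewrite !IH subrr.
Qed.

(** The [n]-fold difference vanishes in negative degrees and beyond degree [n];
    were it nondecreasing, it would vanish everywhere. *)
Lemma mono_count_bound F : F != set0 ->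
  ~ (forall j, 0 <= iter n.+1 delta (fun j => (mono_count F j)%:Z) j).
Proof.
move=> F0 h; case/eqP: F0; apply: mono_count_eq0 => j; apply/eqP.
rewrite -eqz_nat; apply/eqP; move: j.
apply: (@iter_delta_inj n _ (fun=> 0)) => // j; rewrite iter_delta0.
set f := (fun j => (mono_count F j)%:Z) in h *.
have neg k : iter n delta f (Negz k) = 0 by apply: delta_neg.
case: j => [k|k]; last exact: neg.
have step i : iter n delta f i%:Z <= iter n delta f i.+1%:Z.
  have := h i.+1%:Z; rewrite iterS /delta subr_ge0 (_ : i.+1%:Z - 1 = i) //; lia.
have ge0 i : 0 <= iter n delta f i%:Z.
  elim: i => [|i IHi]; last exact: le_trans (step i).
  by have := h 0; rewrite iterS /delta -[0 - 1]/(Negz 0) neg subr0.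
have mono i l : iter n delta f i%:Z <= iter n delta f (i + l)%N%:Z.
  by elim: l => [|l IHl]; rewrite ?addn0 // addnS; apply: le_trans (step _).
apply/eqP; rewrite eq_le ge0 andbT (le_trans (mono k n.+1)) //.
rewrite delta_mono_count big1 // => A _; apply: iter_delta_supp_high; last by lia.
exact: card_ord_le.
Qed.

Lemma big_powersetU1 (f : {set 'I_n} -> int) i E : i \notin E ->
  \sum_(A in powerset (i |: E)) f A = \sum_(A in powerset E) (f A + f (i |: A)).
Proof.
move=> iE; rewrite (bigID (fun A : {set 'I_n} => i \in A)) /= addrC big_split /=.
congr (_ + _).
  apply: eq_bigl => A; rewrite !inE; apply/andP/idP => [[AE iA]|AE].
    by have : A \subset (i |: E) :\ i by [rewrite subsetD1 AE iA]; rewrite setU1K.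
  split; first exact: subset_trans (subsetUr _ _).
  by apply: contra iE; apply: (subsetP AE).
rewrite (reindex_onto (fun A => i |: A) (fun A => A :\ i)) /=; last first.
  by move=> A /andP[_ iA]; rewrite setD1K.
apply: eq_bigl => A; rewrite !inE eqxx /= andbT; apply/andP/idP => [[sub /eqP AE]|AE].
  rewrite -AE; apply/subsetP => x; rewrite !inE => /andP[xi /orP[/eqP h|xA]].
    by rewrite h eqxx in xi.
  by have /subsetP/(_ x) := sub; rewrite !inE xA orbT (negPf xi) => /(_ isT).
split; first exact: setUS.
by apply/eqP/setU1K; apply: contra iE; apply: (subsetP AE).
Qed.

(** The monomials with support in [E] form a polynomial ring in [#|E|]
    variables. *)
Lemma delta_powerset E j :
  iter #|E| delta (fun j => (mono_count (powerset E) j)%:Z) j = supp_fun 0 j.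
Proof.
have [m] := ubnP #|E|; elim: m E j => // m IH E j lem.
have [->|/set0Pn[i iE]] := eqVneq E set0.
  by rewrite cards0 /= mono_countE powerset0 big_set1 cards0.
have cE : #|E| = #|E :\ i|.+1 by rewrite (cardsD1 i E) iE.
rewrite cE iterSr -(IH (E :\ i)); last by rewrite -ltnS -cE.
apply: eq_iter_delta => {}j; rewrite -(setD1K iE) setU1K ?setD11 //.
rewrite /delta !mono_countE !(@big_powersetU1 (fun A => supp_fun #|A| _)) ?setD11 //.
rewrite -sumrB; apply: eq_bigr => A; rewrite inE => AE.
have iA : i \notin A by apply/negP => /(subsetP AE); rewrite setD11.
rewrite cardsU1 iA add1n opprD addrACA -/(delta (supp_fun #|A|.+1) j).
by rewrite delta_supp_fun subrK.
Qed.

(** Dividing a monomial with support [E] by the product of the variables of [E]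
    gives an arbitrary monomial in these variables. *)
Lemma supp_fun_powerset E j :
  supp_fun #|E| j = (mono_count (powerset E) (j - #|E|%:Z))%:Z.
Proof.
apply: (@iter_delta_inj #|E| _ (fun j => (mono_count (powerset E) (j - #|E|%:Z))%:Z)).
  by move=> k; rewrite NegzE -opprD -PoszD addSn.
move=> {}j; rewrite (iter_delta_shift _ _ (fun j => (mono_count (powerset E) j)%:Z)).
by rewrite delta_powerset iter_delta_supp leqnn subnn.
Qed.

(** The members of [F] of size greater than [d] contribute shifted polynomial
    rings in more than [d] variables; the others contribute a polynomial
    multiple of the Hilbert series of [d] variables, with coefficients
    [beta d F k]. *)
Lemma mono_count_decomp d F (E : nat -> {set 'I_n}) j :
    (forall e, (e <= n)%N -> #|E e| = e) -> (d <= n)%N ->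
  (mono_count F j)%:Z =
    \sum_(k < d.+1) beta d F k * (mono_count (powerset (E d)) (j - k%:Z))%:Z
    + \sum_(A in F | (d < #|A|)%N) (mono_count (powerset (E #|A|)) (j - #|A|%:Z))%:Z.
Proof.
move=> cE dn; rewrite mono_countE (bigID (fun A => (d < #|A|)%N)) /= addrC.
congr (_ + _); last first.
  apply: eq_bigr => A _; have An : (#|A| <= n)%N by apply: card_ord_le.
  by rewrite -{1}(cE _ An) supp_fun_powerset cE.
move: j; apply: (@iter_delta_inj d) => [k|j].
  rewrite [LHS]big1 ?[RHS]big1 // => i _.
  have -> : Negz k - i%:Z = Negz (k + i) by rewrite !NegzE -opprD -PoszD addSn.
  by rewrite mulr0.
rewrite !iter_delta_sum.
under [RHS]eq_bigr => k _.
  rewrite iter_deltaZ (iter_delta_shift _ _ (fun j => (mono_count (powerset (E d)) j)%:Z)).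
  rewrite -[X in iter X _ _](cE d dn) delta_powerset.
over.
case: j => [k|k]; last first.
  rewrite !big1 // => [i _|A _]; last by rewrite delta_neg.
  by rewrite NegzE -opprD -PoszD addSn /= mulr0.
case: (leqP k d) => kd.
  rewrite (bigD1 (Ordinal (kd : (k < d.+1)%N))) //= subrr mulr1 [X in _ + X]big1 ?addr0.
    rewrite /beta big_mkcondr [RHS]big_mkcondr; apply: eq_bigr => A _.
    rewrite iter_delta_supp_low // -leqNgt.
    by case: (leqP #|A| k) => [Ak|_]; [rewrite (leq_trans Ak kd)|case: ifP].
  move=> i ik; case E1: (k%:Z - i%:Z) => [[|l]|l] /=; rewrite ?mulr0 //.
  by case/eqP: ik; apply: val_inj => /=; lia.
rewrite !big1 // => [i _|A /andP[_]].
  by case E1: (k%:Z - i%:Z) => [[|l]|l] /=; rewrite ?mulr0 //; case: i E1 => i /=; lia.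
by rewrite -leqNgt => Ad; rewrite iter_delta_supp_high.
Qed.

End Decomposition.

(** * Squarefree monomial ideals *)

Section SquarefreeIdeal.
Variables (K : fieldType) (n : nat) (I : idealr {mpoly K[n]}).
Hypothesis I_sqf : squarefree_monomial_ideal I.
Local Notation S := {mpoly K[n]}.
Local Notation piI := \pi_{ideal_quot I}%qT.

(** The generators enter only through divisibility of monomials. *)
Lemma monomial_idealP : exists G : seq 'X_{1..n},
  [/\ all (@squarefree_mnm n) G,
      forall f m, f \in I -> m \in msupp f -> exists2 g, g \in G & (g <= m)%MM
    & forall g m, g \in G -> (g <= m)%MM -> ('X_[m] : S) \in I].
Proof.
have [G sG defI] := I_sqf; exists G; split=> // [f m' /defI[c ->]|g m' gG gm].
  rewrite mcoeff_msupp mcoeff_sum => nz.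
  have [/existsP[i]|/existsPn no] := boolP [exists i : 'I_(size G),
      (c i * 'X_[nth 0%MM G i])@_m' != 0].
    rewrite -mcoeff_msupp (perm_mem (msuppMX _ _)) => /mapP[k _ ->].
    exists (nth 0%MM G i); first exact: mem_nth.
    exact: lem_addr.
  by case/eqP: nz; apply: big1 => i _; apply/eqP/negPn.
apply/defI; have iG : (index g G < size G)%N by rewrite index_mem.
exists (fun i => if i == Ordinal iG then 'X_[m' - g] else 0).
rewrite (bigD1 (Ordinal iG)) //= eqxx big1 => [|i /negPf->]; last by rewrite mul0r.
by rewrite addr0 nth_index // -mpolyXD submK.
Qed.

Lemma msupport_mesym1 (A : {set 'I_n}) : msupport (mesym1 A) = A.
Proof. by apply/setP => i; rewrite inE mnmE lt0b. Qed.

Lemma mesym1_le (m : 'X_{1..n}) : (mesym1 (msupport m) <= m)%MM.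
Proof. by apply/mnm_lepP => i; rewrite mnmE inE; case: (m i). Qed.

(** A squarefree monomial divides [m] if and only if it divides the product of
    the variables of [m]. *)
Lemma monomial_support m : (('X_[m] : S) \in I) = (('X_[mesym1 (msupport m)] : S) \in I).
Proof.
have [G [/allP sG h1 h2]] := monomial_idealP.
apply/idP/idP => [mI|mI].
  have [|g gG gm] := h1 _ m mI; first by rewrite msuppX mem_head.
  apply: (h2 _ _ gG); apply/mnm_lepP => i; rewrite mnmE inE.
  have /forallP/(_ i) := sG _ gG; have /mnm_lepP/(_ i) := gm.
  by case: (m i) => // -[].
have [|g gG gm] := h1 _ (mesym1 (msupport m)) mI; first by rewrite msuppX mem_head.
apply: (h2 _ _ gG); apply/mnm_lepP => i; have /mnm_lepP/(_ i) := gm.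
by move/leq_trans; apply; have /mnm_lepP := mesym1_le m.
Qed.

Definition faces : {set {set 'I_n}} := [set A | ('X_[mesym1 A] : S) \notin I].

Lemma mem_faces m : (msupport m \in faces) = (('X_[m] : S) \notin I).
Proof. by rewrite inE -monomial_support. Qed.

Lemma ideal_msupp f m : f \in I -> m \in msupp f -> ('X_[m] : S) \in I.
Proof.
move=> fI mf; have [G [_ h1 h2]] := monomial_idealP.
by have [g gG gm] := h1 f m fI mf; apply: h2 gm.
Qed.

Lemma faces_closed (A B : {set 'I_n}) : A \in faces -> B \subset A -> B \in faces.
Proof.
rewrite !inE => AI BA; apply: contra AI => BI.
rewrite (_ : mesym1 A = (mesym1 A - mesym1 B) + mesym1 B)%MM; last first.
  rewrite submK //; apply/mnm_lepP => i; rewrite !mnmE; have := subsetP BA i.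
  by do 2!case: (i \in _) => //; move=> /(_ isT).
by rewrite mpolyXD idealMr.
Qed.

Lemma set0_faces : set0 \in faces.
Proof. by rewrite -(@msupport0 n) mem_faces mpolyX0 idealr1. Qed.

Lemma faces_proper f : f \in I -> f != 0 -> ~: faces != set0.
Proof.
move=> fI f0; apply/set0Pn; exists (msupport (mlead f)).
by rewrite in_setC mem_faces negbK (ideal_msupp fI) // mlead_supp.
Qed.

(** For [F] the faces of an ideal, the second sum lies in the ideal; for [F] the
    non-faces, it vanishes on the members of the ideal. *)
Lemma homog_split F k (f : S) : f \is k.-homog ->
  f = \sum_(i < #|monomials F k|) (f@_(enum_val i))%:MP * 'X_[enum_val i]
    + \sum_(m : 'X_{1..n < k.+1} | msupport m \notin F) (f@_m)%:MP * 'X_[m].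
Proof.
move=> fk; have fs : (msize f <= k.+1)%N.
  rewrite msizeE; apply/bigmax_leqP_seq => m mf _.
  by rewrite (dhomogP _ _ _ fk m mf).
rewrite -(big_enum_val (fun m : 'X_{1..n < k.+1} => (f@_m)%:MP * 'X_[m])) /=.
rewrite {1}(mpolywE fs) (bigID (fun m : 'X_{1..n < k.+1} => m \in monomials F k)) /=.
congr (_ + _); first by apply: eq_bigr => m _; rewrite mul_mpolyC.
rewrite big_mkcond [RHS]big_mkcond; apply: eq_bigr => m _; rewrite inE mul_mpolyC.
have [dm|dm] := eqVneq (mdeg m) k; first by [].
rewrite /= memN_msupp_eq0 ?scale0r ?if_same //.
by apply: contra dm => /(dhomogP _ _ _ fk) ->.
Qed.

Lemma mcoeff_monomial_comb N (b : 'I_N -> 'X_{1..n}) (c : 'I_N -> K) i : injective b ->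
  (\sum_j (c j)%:MP * 'X_[b j] : S)@_(b i) = c i.
Proof.
move=> bi; rewrite mcoeff_sum (bigD1 i) //= mcoeffCM mcoeffX eqxx mulr1.
by rewrite big1 ?addr0 // => j ji; rewrite mcoeffCM mcoeffX (inj_eq bi) (negPf ji) mulr0.
Qed.

Lemma hilbert_ideal : hilbert (@ideal_deg K n I) = mono_count (~: faces).
Proof.
apply/funext => -[k|k]; last first.
  rewrite /hilbert (@K_dimE _ _ _ _ 0 (fun=> 0)) //; split; [by case|by move=> c _ []|move=> u u0].
  by exists (fun=> 0); rewrite big_ord0; apply: val_inj.
set A := monomials (~: faces) k.
have XI (i : 'I_#|A|) : ('X_[enum_val i] : S) \in I.
  by have := enum_valP i; rewrite in_set in_setC mem_faces negbK => /andP[].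
pose b (i : 'I_#|A|) : ideal_mod I := IdealMod (XI i).
have bi : injective (fun i : 'I_#|A| => val (enum_val i)).
  by move=> i j /val_inj /enum_val_inj.
have valE (c : 'I_#|A| -> K) : val (\sum_i (c i)%:MP *: b i) = \sum_i (c i)%:MP * 'X_[enum_val i].
  by rewrite raddf_sum.
rewrite /hilbert (@K_dimE _ _ _ _ _ b) //; split.
- by move=> i; rewrite /= /ideal_deg /= dhomogX; have := enum_valP i; rewrite inE => /andP[].
- move=> c /(congr1 val); rewrite valE raddf0 => c0 i.
  by rewrite -(@mcoeff_monomial_comb _ _ c i bi) c0 mcoeff0.
- move=> u /= uk; exists (fun i : 'I_#|A| => (val u)@_(val (enum_val i))); apply: val_inj.
  rewrite valE [LHS](homog_split (~: faces) uk) [X in _ + X]big1 ?addr0 // => m.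
  rewrite in_setC mem_faces negbK => mI; rewrite memN_msupp_eq0 ?mul0r ?rmorph0 ?mul0r //.
  by apply: contra mI => /(ideal_msupp (valP u)).
Qed.

Lemma pi_eq0 (f : S) : (piI f == 0 :> {ideal_quot I}) = (f \in I).
Proof. by rewrite -(raddf0 piI) -Quotient.idealrBE subr0. Qed.

Lemma scale_pi (f g : S) : f *: (piI g : quot_mod I) = (piI (f * g) : quot_mod I).
Proof. by rewrite [LHS]/(_ *: _) /= /quot_scale rmorphM. Qed.

Lemma hilbert_quot : hilbert (@quot_deg K n I) = mono_count faces.
Proof.
apply/funext => -[k|k]; last first.
  rewrite /hilbert (@K_dimE _ _ _ _ 0 (fun=> 0)) //; split; [by case|by move=> c _ []|move=> u [f /= -> ->]].
  by exists (fun=> 0); rewrite big_ord0 raddf0.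
set A := monomials faces k.
pose b (i : 'I_#|A|) : quot_mod I := piI 'X_[enum_val i].
have bi : injective (fun i : 'I_#|A| => val (enum_val i)).
  by move=> i j /val_inj /enum_val_inj.
have piE (c : 'I_#|A| -> K) : \sum_i (c i)%:MP *: b i = piI (\sum_i (c i)%:MP * 'X_[enum_val i]).
  by rewrite raddf_sum; apply: eq_bigr => i _; rewrite scale_pi.
rewrite /hilbert (@K_dimE _ _ _ _ _ b) //; split.
- move=> i; exists 'X_[enum_val i] => //=; rewrite dhomogX.
  by have := enum_valP i; rewrite inE => /andP[].
- move=> c; rewrite piE => /eqP; rewrite pi_eq0 => cI i.
  apply/eqP/negPn/negP => ci0.
  have : val (enum_val i) \in msupp (\sum_i (c i)%:MP * 'X_[enum_val i]).
    by rewrite mcoeff_msupp (@mcoeff_monomial_comb _ _ c i bi).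
  move/(ideal_msupp cI); apply/negP; rewrite -mem_faces.
  by have := enum_valP i; rewrite inE => /andP[].
- move=> _ [f /= fk ->]; exists (fun i : 'I_#|A| => f@_(val (enum_val i))); rewrite piE.
  apply/eqP; rewrite -subr_eq0 -raddfB pi_eq0 {1}(homog_split faces fk) addrC addKr.
  by apply: rpred_sum => m; rewrite mem_faces negbK => mI; apply: idealMr.
Qed.

End SquarefreeIdeal.

(** * Polynomial rings in fewer variables *)

Section Block.
Variables (K : fieldType) (n : nat) (E : {set 'I_n}).
Local Notation S := {mpoly K[n]}.

(** The ideal generated by the variables outside [E], described by the supports
    of the monomials of its members; the quotient by it is the polynomial ring
    in the variables of [E]. *)
Definition block_pred : {pred S} :=
  fun f => all (fun m => ~~ (msupport m \subset E)) (msupp f).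

Lemma block_predP (f : S) :
  reflect (forall m, m \in msupp f -> ~~ (msupport m \subset E)) (f \in block_pred).
Proof. exact: allP. Qed.

Lemma msupport_sub_addl (m k : 'X_{1..n}) :
  msupport (m + k)%MM \subset E -> msupport k \subset E.
Proof.
apply: subset_trans; apply/subsetP => i; rewrite !inE mnmDE addn_gt0 => ->.
by rewrite orbT.
Qed.

Lemma block_idealr_closed : idealr_closed block_pred.
Proof.
split.
- by apply/block_predP => m; rewrite msupp0.
- apply/negP => /block_predP/(_ 0%MM); rewrite msupp1 mem_head => /(_ isT).
  by rewrite msupport0 sub0set.
- move=> a u v /block_predP hu /block_predP hv; apply/block_predP => m.
  move/msuppD_le; rewrite mem_cat => /orP[|/hv //].
  move/msuppM_le/allpairsP => [[p q] /= [_ /hu hq ->]].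
  by apply: contra hq; apply: msupport_sub_addl.
Qed.

HB.instance Definition _ := isIdealr.Build S block_pred block_idealr_closed.

Definition block : idealr S := block_pred.

Lemma blockX m : (('X_[m] : S) \in block) = ~~ (msupport m \subset E).
Proof. by rewrite [LHS]/(all _ _) msuppX /= andbT. Qed.

Lemma block_gens (f : S) : f \in block ->
  exists g : 'I_n -> S, f = \sum_(i in ~: E) g i * 'X_i.
Proof.
move=> /block_predP h; apply: sum_vars_of_support => m /h /subsetPn[i].
by rewrite inE => mi iE; exists i; rewrite // inE.
Qed.

Lemma msupportU i : msupport U_(i)%MM = [set i] :> {set 'I_n}.
Proof. by rewrite -[X in msupport X]add0m msupportDU msupport0 setU0. Qed.

Lemma block_sqf : squarefree_monomial_ideal block.
Proof.
exists [seq U_(i)%MM | i <- enum (~: E)].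
  apply/allP => _ /mapP[i _ ->]; apply/forallP => j; rewrite mnm1E.
  by case: eqP.
move=> f; split.
  move=> /block_gens[g ->]; set G := [seq _ | _ <- _].
  pose c (l : 'I_(size G)) : S := if insub (l : nat) is Some k then g (enum_val (k : 'I_#|~: E|)) else 0.
  exists c; rewrite big_enum_val.
  have szG : size G = #|~: E| by rewrite size_map -cardE.
  rewrite (reindex (cast_ord szG)) /=; last first.
    by exists (cast_ord (esym szG)) => i _; rewrite ?cast_ordK ?cast_ordKV.
  apply: eq_bigr => i _; have iG : (i < #|~: E|)%N by rewrite -szG.
  rewrite /c insubT; congr (g (enum_val _) * 'X_[_]); first exact: val_inj.
  rewrite (nth_map (enum_val (cast_ord szG i))) -?cardE //.
  by rewrite -(enum_val_nth _ (cast_ord szG i)).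
move=> [c ->]; apply: rpred_sum => i _; apply: idealMr; rewrite blockX.
have := mem_nth 0%MM (ltn_ord i); move: (nth _ _ _) => m /mapP[j].
by rewrite mem_enum inE => jE ->; rewrite msupportU sub1set.
Qed.

Lemma faces_block : faces block = powerset E.
Proof. by apply/setP => A; rewrite !inE blockX negbK msupport_mesym1. Qed.

End Block.

Section BlockRegular.
Variables (K : fieldType) (n : nat).
Local Notation S := {mpoly K[n]}.
Local Notation vars := (vars K n).

Definition initial (e : nat) : {set 'I_n} := [set i : 'I_n | (i < e)%N].
Definition middle (d e : nat) : {set 'I_n} := [set i : 'I_n | (d <= i < e)%N].

Lemma card_initial e : (e <= n)%N -> #|initial e| = e.
Proof.
move=> en; rewrite -[RHS](card_ord e) -(card_imset predT (f := widen_ord en)) /=.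
  apply: eq_card => i; rewrite inE; apply/idP/imsetP => [ie|[j _ ->]]; last exact: (ltn_ord j).
  by exists (Ordinal ie) => //; apply: val_inj.
by move=> i j /(congr1 val) /= /val_inj.
Qed.

Lemma nth_take_vars d (i : 'I_n) : (i < d)%N -> (take d vars)`_i = 'X_i.
Proof. by move=> id; rewrite nth_take // nth_vars. Qed.

Lemma size_take_vars d : (d <= n)%N -> size (take d vars) = d.
Proof. by move=> dn; rewrite size_takel // size_vars. Qed.

Local Notation N e := (quot_mod (block K (initial e))).
Local Notation pi e f := (\pi_{ideal_quot (block K (initial e))}%qT f : N e).

(** Modulo the variables outside [initial e] and the first [d] ones, only the
    variables between [d] and [e] survive. *)
Lemma seq_mul_block d e (f : S) : (d <= e)%N -> (d <= n)%N ->
  seq_mul (take d vars) (pi e f) <-> f \in block K (middle d e).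
Proof.
move=> de dn; rewrite seq_mulP size_take_vars //; split.
  move=> [w fE].
  have /choice[g gE] : forall l, exists g : S, w l = pi e g.
    by move=> l; exists (repr (w l : {ideal_quot (block K (initial e))})); rewrite reprK.
  have : f - \sum_(l < d) (take d vars)`_l * g l \in block K (initial e).
    rewrite -pi_eq0 raddfB subr_eq0; apply/eqP; apply: etrans fE _.
    by rewrite raddf_sum; apply: eq_bigr => l _; rewrite gE scale_pi.
  set s := \sum_(l < d) _ => fs; rewrite -[f](subrK s); apply: rpredD.
    move: fs => /block_predP h; apply/block_predP => m /h; apply: contra.
    by move/subset_trans; apply; apply/subsetP => i; rewrite !inE => /andP[].
  apply: rpred_sum => l _; rewrite mulrC; apply: idealMr.
  have ln : (l < n)%N by apply: leq_trans (ltn_ord l) dn.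
  rewrite (nth_take_vars (i := Ordinal ln)) //=; apply: etrans (blockX K _ _) _.
  by rewrite msupportU sub1set inE /= leqNgt ltn_ord.
move=> /block_gens[g ->].
pose w l : N e := if insub l is Some k then pi e (g k) else 0.
exists w; transitivity (\sum_(i < n | (i < d)%N) (('X_i : S) *: pi e (g i))).
  rewrite raddf_sum big_mkcond [RHS]big_mkcond; apply: eq_bigr => i _.
  rewrite inE inE negb_and -ltnNge -leqNgt; case: ltnP => id /=.
    by rewrite scale_pi mulrC.
  case: leqP => ei //; apply/eqP; rewrite pi_eq0; apply: idealMr.
  by rewrite blockX msupportU sub1set inE -leqNgt.
rewrite [RHS](big_ord_widen n (fun l => (take d vars)`_l *: w l) dn).
by apply: eq_bigr => i id; rewrite /w valK nth_take_vars.
Qed.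

Lemma weakly_regular_block d e : (d <= e <= n)%N ->
  @weakly_regular K n (N e) (take d vars).
Proof.
move=> /andP[de en] i; have dn := leq_trans de en; rewrite size_take_vars // => id v.
have [f ->] : exists f : S, v = pi e f.
  by exists (repr (v : {ideal_quot (block K (initial e))})); rewrite reprK.
have ie : (i < e)%N := leq_trans id de; have i_n := leq_trans ie en.
rewrite take_takel ?(ltnW id) // (nth_take_vars (i := Ordinal i_n)) //.
rewrite scale_pi !seq_mul_block ?(ltnW ie) ?(ltnW i_n) //.
move=> /block_predP h; apply/block_predP => m mf.
have /h : (m + U_(Ordinal i_n))%MM \in msupp ('X_(Ordinal i_n) * f).
  by rewrite mcoeff_msupp mulrC addmC mcoeffMX -mcoeff_msupp.
apply: contra; rewrite msupportDU subUset => ->; rewrite sub1set inE /=.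
by rewrite leqnn ie.
Qed.

Lemma block_proper d e : (d <= e <= n)%N -> ~ seq_mul (take d vars) (pi e 1).
Proof.
move=> /andP[de en]; have dn := leq_trans de en; rewrite seq_mul_block //.
by rewrite idealr1.
Qed.

End BlockRegular.

(** * Modules with a prescribed Hilbert function *)

Section Realizable.
Variables (K : fieldType) (n d : nat).
Hypothesis d_le : (d <= n)%N.
Local Notation S := {mpoly K[n]}.
Local Notation xs := (take d (vars K n)).

Lemma fin_gen_fin (M : lmodType S) (I : finType) (g : I -> M) :
  (forall v, exists c : I -> S, v = \sum_i c i *: g i) -> fin_gen M.
Proof.
move=> gg; exists [seq g i | i <- enum I] => v; have [c ->] := gg v.
have sz : size [seq g i | i <- enum I] = #|I| by rewrite size_map -cardE.
exists (fun i => c (enum_val (cast_ord sz i))).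
rewrite (reindex (@enum_val I I)) /=; last first.
  by exists enum_rank => i _; rewrite ?enum_valK ?enum_rankK.
rewrite (reindex (cast_ord sz)) /=; last first.
  by exists (cast_ord (esym sz)) => i _; rewrite ?cast_ordK ?cast_ordKV.
apply: eq_bigr => i _; congr (_ *: _).
have i_n : (i < size (enum I))%N by rewrite -cardE -sz.
rewrite (nth_map (enum_val (cast_ord sz i))) //.
by rewrite -(enum_val_nth _ (cast_ord sz i)).
Qed.

(** Two elements can be decomposed over a common list of degrees without
    repetitions, as the grading of a direct sum requires. *)
Lemma grading_span_on (M : lmodType S) (Mdeg : int -> M -> Prop) v :
  is_grading Mdeg -> exists s : seq int, forall t, uniq t -> {subset s <= t} ->
    exists c, (forall j, Mdeg j (c j)) /\ v = \sum_(j <- t) c j.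
Proof.
move=> gr; have [s [c [hc ->]]] := grading_span gr v.
exists s => t ut st; exists (fun j => if j \in s then c j *+ count_mem j s else 0).
split=> [j|].
  case: ifP => _; last exact: grading_0.
  elim: (count_mem j s) => [|k IH]; first by rewrite mulr0n; apply: grading_0.
  by rewrite mulrS; apply: grading_add.
rewrite -big_mkcond -big_filter -big_undup_iterop_count; symmetry; apply: perm_big.
apply: uniq_perm; rewrite ?filter_uniq ?undup_uniq // => j.
by rewrite mem_filter mem_undup; case: (boolP (j \in s)) => //= /st.
Qed.

(** Hilbert functions of modules on which the first [d] variables form a regular
    sequence; properness is imposed on nonzero functions only, so that the
    notion is closed under sums, including the empty one. *)
Definition realizable (h : int -> nat) : Prop :=
  exists (N : lmodType S) (Ndeg : int -> N -> Prop),
  [/\ fin_gen N, is_grading Ndeg, hilbert Ndeg = h, @weakly_regular K n N xs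
    & (exists j, h j <> 0%N) -> exists v : N, ~ seq_mul xs v].

Lemma realizable0 : realizable (fun=> 0%N).
Proof.
exists 'rV[S]_0, (fun _ _ => True).
have v0 (v : 'rV[S]_0) : v = 0 by apply/rowP => -[].
split=> //.
- by exists [::] => v; exists (fun=> 0); rewrite (v0 v) big_ord0.
- split=> // v; exists [::], (fun=> 0).
  by rewrite big_nil; split=> //; apply: v0.
- apply/funext => j; apply: (@K_dimE _ _ _ _ 0 (fun=> 0)); split; [by case|by move=> c _ []|].
  by move=> u _; exists (fun=> 0); rewrite big_ord0; apply: v0.
- move=> i _ v _; rewrite (v0 v); apply/seq_mulP; exists (fun=> 0).
  by rewrite big1 // => l _; rewrite scaler0.
- by case.
Qed.

Lemma fst_sum (M1 M2 : lmodType S) I (r : seq I) (P : pred I) (v : I -> M1 * M2) :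
  (\sum_(i <- r | P i) v i).1 = \sum_(i <- r | P i) (v i).1.
Proof. exact: (big_morph fst (fun x y => erefl) erefl). Qed.

Lemma snd_sum (M1 M2 : lmodType S) I (r : seq I) (P : pred I) (v : I -> M1 * M2) :
  (\sum_(i <- r | P i) v i).2 = \sum_(i <- r | P i) (v i).2.
Proof. exact: (big_morph snd (fun x y => erefl) erefl). Qed.

Lemma seq_mul_pair (M1 M2 : lmodType S) fs (v : M1 * M2) :
  seq_mul fs v <-> seq_mul fs v.1 /\ seq_mul fs v.2.
Proof.
split=> [[w ->]|[[w1 e1] [w2 e2]]].
  by split; [exists (fun i => (w i).1)|exists (fun i => (w i).2)]; rewrite ?fst_sum ?snd_sum.
exists (fun i => (w1 i, w2 i)); rewrite (surjective_pairing v) e1 e2.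
rewrite [RHS]surjective_pairing fst_sum snd_sum //.
Qed.

Lemma realizable_add h1 h2 :
  realizable h1 -> realizable h2 -> realizable (fun j => (h1 j + h2 j)%N).
Proof.
move=> [M1 [D1 [fg1 gr1 hh1 wr1 pr1]]] [M2 [D2 [fg2 gr2 hh2 wr2 pr2]]].
exists (M1 * M2)%type, (fun j v => D1 j v.1 /\ D2 j v.2); split.
- have [s1 g1] := fg1; have [s2 g2] := fg2.
  apply: (@fin_gen_fin _ ('I_(size s1) + 'I_(size s2))%type
    (fun i => match i with inl i => (s1`_i, 0) | inr i => (0, s2`_i) end)) => v.
  have [c1 e1] := g1 v.1; have [c2 e2] := g2 v.2.
  exists (fun i => match i with inl i => c1 i | inr i => c2 i end).
  rewrite big_sumType [RHS]surjective_pairing [LHS]surjective_pairing; congr (_, _).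
    rewrite /= !fst_sum [X in _ + X]big1 ?addr0 // => i _; exact: scaler0.
  rewrite /= !snd_sum [X in X + _]big1 ?add0r // => i _; exact: scaler0.
- split.
  + by move=> j; split; apply: grading_0.
  + by move=> j u v [? ?] [? ?]; split; apply: grading_add.
  + by move=> k j f v hf [? ?]; split; apply: grading_scale.
  + move=> v; have [s1 h1s] := grading_span_on v.1 gr1.
    have [s2 h2s] := grading_span_on v.2 gr2; pose t := undup (s1 ++ s2).
    have tu : uniq t by apply: undup_uniq.
    have st1 : {subset s1 <= t} by move=> j js; rewrite mem_undup mem_cat js.
    have st2 : {subset s2 <= t} by move=> j js; rewrite mem_undup mem_cat js orbT.
    have [c1 [hc1 e1]] := h1s t tu st1; have [c2 [hc2 e2]] := h2s t tu st2.
    exists t, (fun j => (c1 j, c2 j)); split=> //.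
    by rewrite [RHS]surjective_pairing fst_sum snd_sum -e1 -e2 -surjective_pairing.
  + move=> s c us hc s0 j js; rewrite [LHS]surjective_pairing; congr (_, _).
      apply: (@grading_direct _ _ _ _ gr1 s (fun j => (c j).1) us _ _ j js) => [i|].
        by case: (hc i).
      by rewrite -fst_sum s0.
    apply: (@grading_direct _ _ _ _ gr2 s (fun j => (c j).2) us _ _ j js) => [i|].
      by case: (hc i).
    by rewrite -snd_sum s0.
- apply/funext => j; rewrite -hh1 -hh2.
  have [b1 [U1 i1 g1]] := hilbert_basis fg1 gr1 j.
  have [b2 [U2 i2 g2]] := hilbert_basis fg2 gr2 j.
  pose b (i : 'I_(hilbert D1 j) + 'I_(hilbert D2 j)) : M1 * M2 :=
    match i with inl i => (b1 i, 0) | inr i => (0, b2 i) end.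
  have bE (c : _ -> K) : \sum_i (c i)%:MP *: b i =
     (\sum_i (c (inl i))%:MP *: b1 i, \sum_i (c (inr i))%:MP *: b2 i).
    rewrite big_sumType [LHS]surjective_pairing; congr (_, _).
      rewrite /= !fst_sum [X in _ + X]big1 ?addr0 // => i _; exact: scaler0.
    rewrite /= !snd_sum [X in X + _]big1 ?add0r // => i _; exact: scaler0.
  have := @K_basis_fin K n _ (fun v => D1 j v.1 /\ D2 j v.2) _ b.
  rewrite /hilbert => kb; rewrite (K_dimE (kb _ _ _)).
  + by rewrite card_sum !card_ord.
  + by case=> i; split=> //=; apply: grading_0.
  + by move=> c; rewrite bE => -[/i1 c1 /i2 c2] [].
  + move=> v [/g1[c1 e1] /g2[c2 e2]].
    exists (fun i => match i with inl i => c1 i | inr i => c2 i end).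
    by rewrite bE -e1 -e2 -surjective_pairing.
- move=> i ixs v /seq_mul_pair[/= hv1 hv2]; apply/seq_mul_pair.
  by split; [apply: wr1|apply: wr2].
- move=> [j hj]; have [h1j|h2j] : h1 j <> 0%N \/ h2 j <> 0%N by lia.
    have [|v hv] := pr1; first by exists j.
    by exists (v, 0) => /seq_mul_pair[].
  have [|v hv] := pr2; first by exists j.
  by exists (0, v) => /seq_mul_pair[].
Qed.

Lemma realizable_shift h (a : int) : realizable h -> realizable (fun j => h (j - a)).
Proof.
move=> [M [D [fg gr hh wr pr]]]; exists M, (fun j => D (j - a)); split=> //.
- split.
  + by move=> j; apply: grading_0.
  + by move=> j u v; apply: grading_add.
  + by move=> k j f v hf hv; rewrite -addrA; apply: grading_scale.
  + move=> v; have [s [c [hc ->]]] := grading_span gr v.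
    exists [seq j + a | j <- s], (fun j => c (j - a)); split=> //.
    by rewrite big_map; apply: eq_bigr => j _; rewrite addrK.
  + move=> s c us hc s0 j js.
    have := @grading_direct _ _ _ _ gr [seq i - a | i <- s] (fun i => c (i + a)).
    rewrite map_inj_uniq => [/(_ us)|x y /addIr //].
    rewrite big_map; under eq_bigr do rewrite subrK.
    move=> /(_ _ s0 (j - a)); rewrite subrK; apply.
      by move=> i; have := hc (i + a); rewrite addrK.
    by apply/mapP; exists j.
- by apply/funext => j; rewrite -hh.
- by move=> [j hj]; apply: pr; exists (j - a).
Qed.

Lemma realizable_mul h c : realizable h -> realizable (fun j => (c * h j)%N).
Proof.
move=> rh; elim: c => [|c IH].
  by rewrite (_ : (fun j => _) = fun=> 0%N) //; exact: realizable0.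
rewrite (_ : (fun j => _) = fun j => (h j + c * h j)%N); first exact: realizable_add.
by apply/funext => j; rewrite mulSn.
Qed.

Lemma realizable_sum I (r : seq I) (P : pred I) (h : I -> int -> nat) :
    (forall i, P i -> realizable (h i)) ->
  realizable (fun j => \sum_(i <- r | P i) h i j)%N.
Proof.
move=> rh; elim: r => [|i r IH].
  rewrite (_ : (fun j => _) = fun=> 0%N); first exact: realizable0.
  by apply/funext => j; rewrite big_nil.
case: (boolP (P i)) => Pi.
  rewrite (_ : (fun j => _) = fun j => (h i j + \sum_(i <- r | P i) h i j)%N).
    by apply: realizable_add => //; apply: rh.
  by apply/funext => j; rewrite big_cons Pi.
rewrite (_ : (fun j => _) = fun j => (\sum_(i <- r | P i) h i j)%N) //.
by apply/funext => j; rewrite big_cons (negPf Pi).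
Qed.

Lemma realizable_powerset e : (d <= e <= n)%N ->
  realizable (mono_count (powerset (initial n e))).
Proof.
move=> de; set J := block K (initial n e); have J_sqf := block_sqf K (initial n e).
exists (quot_mod J), (@quot_deg K n J); split.
- exact: quot_fin_gen.
- exact: quot_grading.
- by rewrite hilbert_quot // faces_block.
- exact: weakly_regular_block.
- by move=> _; exists (\pi_{ideal_quot J}%qT 1); apply: block_proper.
Qed.

Lemma realizable_mono_count (F : {set {set 'I_n}}) :
  (forall k, (k <= d)%N -> 0 <= beta d F k) -> realizable (mono_count F).
Proof.
move=> bF.
rewrite (_ : mono_count F = fun j =>
  (\sum_(k < d.+1) `|beta d F k| * mono_count (powerset (initial n d)) (j - k%:Z)
   + \sum_(A in F | (d < #|A|)%N) mono_count (powerset (initial n #|A|)) (j - #|A|%:Z))%N).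
  apply: realizable_add; apply: realizable_sum.
    move=> k _; apply: realizable_mul; apply: (realizable_shift (h := mono_count _)).
    by apply: realizable_powerset; rewrite leqnn.
  move=> A /andP[_ dA]; apply: (realizable_shift (h := mono_count _)).
  by apply: realizable_powerset; rewrite (ltnW dA) card_ord_le.
apply/funext => j; apply/eqP; rewrite -eqz_nat PoszD; apply/eqP.
rewrite (mono_count_decomp F j (@card_initial n) d_le).
rewrite !(big_morph Posz PoszD (erefl _)); congr (_ + _).
apply: eq_bigr => k _; rewrite PoszM gez0_abs // bF //; exact: (ltn_ord k).
Qed.

End Realizable.

(** * Hilbert depth *)

Lemma nat_max_neq0 (P : nat -> Prop) : nat_max P != 0%N -> P (nat_max P).
Proof.
rewrite /nat_max; case: classical_sets.xgetP => [m -> []//|_ /eqP//].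
Qed.

(** A bounded nonempty set has a maximum, so that [nat_max] does not take its
    default value. *)
Lemma nat_max_ub (P : nat -> Prop) B k :
  (forall k, P k -> (k <= B)%N) -> P k -> P (nat_max P) /\ (k <= nat_max P)%N.
Proof.
move=> hB Pk.
have exP : exists k, `[< P k >] by exists k; apply/asboolP.
have ubP i : `[< P i >] -> (i <= B)%N by move/asboolP/hB.
have [m /asboolP Pm mmax] := ex_maxnP exP ubP.
have mm i : P i -> (i <= m)%N by move=> Pi; apply: mmax; apply/asboolP.
rewrite /nat_max; case: classical_sets.xgetP => [_ -> [Pm' h]|/(_ m) []]; last by split.
by split=> //; apply: h.
Qed.

Section Depth.
Variables (K : fieldType) (n : nat) (N : lmodType {mpoly K[n]}).
Variables (Ndeg : int -> N -> Prop) (F : {set {set 'I_n}}).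
Hypotheses (N_fg : fin_gen N) (N_gr : is_grading Ndeg) (F0 : F != set0).
Hypothesis N_hilb : hilbert Ndeg = mono_count F.
Local Notation S := {mpoly K[n]}.

(** The first [n + 1] elements of a longer sequence would contradict
    [mono_count_bound]. *)
Lemma regular_seq_size (fs : seq S) : (forall f, f \in fs -> f@_0 = 0) ->
  regular_seq N fs -> (size fs <= n)%N.
Proof.
move=> fs0 reg; rewrite leqNgt; apply/negP => lt.
case: (mono_count_bound F0).
have := @weakly_regular_delta _ _ _ _ N_fg N_gr (take n.+1 fs) _ (regular_seq_take (m := n.+1) reg).
by rewrite N_hilb size_takel //; apply => f /mem_take /fs0.
Qed.

Lemma depth_ge (fs : seq S) : (forall f, f \in fs -> f@_0 = 0) ->
  regular_seq N fs -> (size fs <= depth N <= n)%N.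
Proof.
move=> fs0 reg; pose P r := exists fs : seq S,
  [/\ size fs = r, forall f, f \in fs -> f@_0 = 0 & regular_seq N fs].
have ub r : P r -> (r <= n)%N by move=> [gs [<- gs0 greg]]; apply: regular_seq_size.
have [] := @nat_max_ub P n (size fs) ub; first by exists fs.
by move=> /ub h1 h2; rewrite /depth h2.
Qed.

Lemma depth_beta : depth N != 0%N ->
  (depth N <= n)%N /\ forall k, (k <= depth N)%N -> 0 <= beta (depth N) F k.
Proof.
move=> /nat_max_neq0[fs [sz fs0 reg]]; rewrite -/(depth N) in sz; rewrite -sz.
split; first exact: regular_seq_size.
move=> k kd; rewrite -delta_mono_count_beta //.
have := @weakly_regular_delta _ _ _ _ N_fg N_gr (take (size fs) fs) _ (regular_seq_take (m := size fs) reg).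
by rewrite N_hilb take_size; apply.
Qed.

Lemma depth_le : (depth N <= n)%N.
Proof. by have [->|/depth_beta[]] := eqVneq (depth N) 0%N. Qed.

End Depth.

Theorem corollary4p5 (K : fieldType) (n : nat) (n_le7 : (n <= 7)%N)
    (I : idealr {mpoly K[n]})
    (I_neq0 : exists2 f : {mpoly K[n]}, f \in I & f != 0)
    (I_sqf : squarefree_monomial_ideal I) :
  (hdepth (@quot_deg K n I) <= hdepth (@ideal_deg K n I))%N.
Proof.
have [->//|hd0] := eqVneq (hdepth (@quot_deg K n I)) 0%N.
have [N [Ndeg [N_fg N_gr]]] := nat_max_neq0 hd0.
rewrite -/(hdepth _) => N_hilb dN; rewrite -dN in hd0 *.
rewrite hilbert_quot // in N_hilb.
have F0 : faces I != set0 by apply/set0Pn; exists set0; apply: set0_faces.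
have [dn bF] := depth_beta N_fg N_gr F0 N_hilb hd0.
have [f fI f0] := I_neq0; have G0 := faces_proper I_sqf fI f0.
have bG : forall k, (k <= depth N)%N -> 0 <= beta (depth N) (~: faces I) k.
  apply: beta_complement => //; first exact: faces_closed.
    exact: set0_faces.
  by rewrite lt0n hd0.
have [N' [N'deg [N'_fg N'_gr N'_hilb wr pr]]] := realizable_mono_count K dn bG.
have reg : regular_seq N' (take (depth N) (vars K n)).
  split=> //; apply: pr; apply: contrapT => no; case/eqP: G0.
  by apply: mono_count_eq0 => j; apply: contrapT => hj; apply: no; exists j.
have x0 g : g \in take (depth N) (vars K n) -> g@_0 = 0.
  move=> /mem_take/mapP[i _ ->]; rewrite mcoeffX; case: eqP => // /mnmP/(_ i).
  by rewrite mnm1E mnm0E eqxx.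
have /andP[le _] := depth_ge N'_fg N'_gr G0 N'_hilb x0 reg.
rewrite size_take_vars // in le; apply: leq_trans le _.
have [||_ //] := @nat_max_ub (fun r => exists (N : lmodType {mpoly K[n]}) (Ndeg : int -> N -> Prop),
    [/\ fin_gen N, is_grading Ndeg, hilbert Ndeg = hilbert (@ideal_deg K n I)
      & depth N = r]) n (depth N').
- move=> _ [P [Pdeg [P_fg P_gr P_hilb <-]]]; rewrite hilbert_ideal // in P_hilb.
  exact: depth_le P_fg P_gr G0 P_hilb.
- by exists N', N'deg; split=> //; rewrite hilbert_ideal.
Qed.
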